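(* Let $X$ be a manifold with corners and $\mathcal E$ an index family on $X$ all of whose exponents are real. Suppose that $g\in\mathcal A^{\mathcal E}_{\mathrm{phg}}(X)$ is real-valued, with $\inf\mathcal E\ge0$. Suppose that $f:\mathbb R\to\mathbb R$ is smooth on an open set compactly containing the image of $g$. Then the composition $f\circ g$ is polyhomogeneous conormal on $X$ (with respect to some index family).
   Context: Manifolds with corners have finitely many, embedded boundary hypersurfaces $\mathcal F_1,\dots,\mathcal F_n$, each with a boundary defining function $\rho_{\mathcal F}$. An open set compactly contains a set $S$ if the closure of $S$ is compact and contained in it. An index set is a (possibly empty) $E\subseteq\mathbb C\times\mathbb N_0$ (here with real exponents: $E\subseteq\mathbb R\times\mathbb N_0$) such that: the (real parts of the) exponents $s$ have a finite minimum and tend to $\infty$ when arranged in increasing order; for each $s$ only finitely many $p$ have $(s,p)\in E$; $(s,p)\in E$ implies $(s+1,p)\in E$ and, if $p>0$, $(s,p-1)\in E$. An index family $\mathcal E$ on $X$ assigns an index set $E_{\mathcal F}$ to each boundary hypersurface $\mathcal F$. $\mathcal A^{\mathcal E}_{\mathrm{phg}}(X)$, the space of polyhomogeneous conormal (pc) functions with index family $\mathcal E$, consists (inductively on $\dim X$) of functions $u$ such that near each $\mathcal F$, $u\sim\sum_{(s,p)\in E_{\mathcal F}}a_{s,p}\rho_{\mathcal F}^s(\log\rho_{\mathcal F})^p$ with coefficients $a_{s,p}$ pc on $\mathcal F$ with the index sets of the hypersurfaces $\mathcal F_i$ meeting $\mathcal F$, and, for all $r$ and all vector fields $V_1,\dots,V_k$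 tangent to the boundary, $|V_1\cdots V_k(u-\sum_{\Re s\le r}a_{s,p}\rho_{\mathcal F}^s(\log\rho_{\mathcal F})^p)|\le C\rho_{\mathcal F}^r\prod_i\rho_{\mathcal F_i}^{-N}$ with $C,N$ depending on $r,V_1,\dots,V_k$ (uniformly on compact sets). For an index set $E$, $\inf E=(s,p)$ is the element with $s$ minimal and, for that $s$, $p$ maximal. $\inf E\ge0$ means $s>0$, or $s=0$ and $p=0$. $\inf\mathcal E\ge0$ means $\inf E\ge0$ for every index set $E$ of $\mathcal E$ (an empty index set counts as satisfying this). *)

(* Defs.v *)
From mathcomp Require Import all_boot all_order all_algebra.
From mathcomp Require Import all_classical all_reals all_analysis.

Set Implicit Arguments.
Unset Strict Implicit.
Unset Printing Implicit Defensive.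

Import Order.TTheory GRing.Theory Num.Theory.
Import numFieldNormedType.Exports.
Local Open Scope classical_set_scope.
Local Open Scope ring_scope.

(* C^oo on an open set O of R^n: every iterated directional derivative is
   differentiable at every point of O. *)
Definition smooth_open (R : realType) (n : nat) (O : set 'rV[R]_n)
    (h : 'rV[R]_n -> R) : Prop :=
  forall (vs : seq 'rV[R]_n) (y : 'rV[R]_n), O y ->
    differentiable (foldr (fun v k => fun z => 'D_v k z) h vs) y.

Definition smooth_line (R : realType) (O : set R) (f : R -> R) : Prop :=
  forall (k : nat) (x : R), O x -> derivable (derive1n k f) x 1.

(* The local model is the closed orthant [0, oo[ ^ n: an open subset of
   [0, oo[ ^ k x R ^ (n - k) is locally diffeomorphic to an open subset of it,
   so points of every depth 0 <= k <= n are covered. *)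
Definition orthant (R : realType) (n : nat) : set 'rV[R]_n :=
  [set y | forall i, 0 <= y ord0 i].

Record corner_chart (R : realType) (n : nat) (T : topologicalType) :=
  CornerChart {
    cdom : set T;
    cmap : T -> 'rV[R]_n;
    cinv : 'rV[R]_n -> T;
    cdom_open : open cdom;
    cmap_image : exists2 O : set 'rV[R]_n, open O &
      cmap @` cdom = O `&` @orthant R n;
    cmapK : forall x, cdom x -> cinv (cmap x) = x;
    cmap_continuous : {within cdom, continuous cmap};
    cinv_continuous : {within cmap @` cdom, continuous cinv} }.

(* h is a smooth extension, to a full neighbourhood of the image of x in R^n,
   of the restriction of u to S read in the chart c. *)
Definition local_extension (R : realType) (n : nat) (T : topologicalType)
    (c : corner_chart R n T) (S : set T) (u : T -> R) (x : T)
    (h : 'rV[R]_n -> R) : Prop :=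
  exists O : set 'rV[R]_n,
    [/\ open O, O (cmap c x), smooth_open O h &
      forall y, cdom c y -> S y -> O (cmap c y) -> u y = h (cmap c y)].

(* A smooth atlas, indexed by the points of T: chart x is a chart around x. *)
Record corner_atlas (R : realType) (n : nat) (T : topologicalType) :=
  CornerAtlas {
    chart :> T -> corner_chart R n T;
    chart_center : forall x, cdom (chart x) x;
    chart_compatible : forall (p q x : T) (i : 'I_n),
      cdom (chart p) x -> cdom (chart q) x ->
      exists h, local_extension (chart q) (cdom (chart p))
                  (fun y => cmap (chart p) y ord0 i) x h }.

Section Atlas.
Variables (R : realType) (n : nat) (T : topologicalType).
Variable A : corner_atlas R n T.
Implicit Types (S : set T) (u : T -> R) (x : T).

Definition smooth_on S u : Prop :=
  forall x, S x -> exists h, local_extension (A x) S u x h.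

Definition smooth_map_on S (f : T -> T) : Prop :=
  {within S, continuous f} /\
  forall (p : T) (i : 'I_n),
    smooth_on (S `&` f @^-1` cdom (A p)) (fun y => cmap (A p) (f y) ord0 i).

Definition depth x : nat := #|[pred i : 'I_n | cmap (A x) x ord0 i == 0]|.

Definition depth1 : set T := [set x | depth x = 1%N].

Definition boundary_hypersurface (H : set T) : Prop :=
  exists x, depth1 x /\ H = closure (connected_component depth1 x).

(* A vector field is given by its components V x in the chart A x centred at
   x. For V tangent to the boundary the line t |-> cmap (A x) x + t V x
   stays, for small t, in the face whose relative interior contains x; so the
   derivative below is also meaningful when x is a boundary point and u is
   only defined and smooth on the relative interior of that face. *)
Definition lie (V : T -> 'rV[R]_n) u : T -> R :=
  fun x => 'D_(V x) (u \o cinv (A x)) (cmap (A x) x).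

(* Smooth vector fields tangent to the boundary: vanishing normal components
   at the boundary, and smooth components in every chart A p (the i-th
   component is the derivative of the i-th coordinate function). *)
Definition b_field (V : T -> 'rV[R]_n) : Prop :=
  (forall x (i : 'I_n), cmap (A x) x ord0 i = 0 -> V x ord0 i = 0) /\
  (forall (p : T) (i : 'I_n),
     smooth_on (cdom (A p)) (lie V (fun y => cmap (A p) y ord0 i))).

End Atlas.

Record mfd_corners (R : realType) (n : nat) (T : topologicalType) :=
  MfdCorners {
    atlas :> corner_atlas R n T;
    mfd_hausdorff : hausdorff_space T;
    mfd_second_countable : @second_countable T;
    nhyp : nat;
    hyp : 'I_nhyp -> set T;
    hyp_inj : injective hyp;
    hypE : forall H : set T,
      boundary_hypersurface atlas H <-> exists j, hyp j = H;
    (* embeddedness: near any of its points, a hypersurface is the zero set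
       of a single coordinate *)
    hyp_embedded : forall j x, hyp j x -> exists i : 'I_n,
      \forall y \near x, cdom (atlas x) y /\
        (hyp j y <-> cmap (atlas x) y ord0 i = 0);
    bdf : 'I_nhyp -> T -> R;
    bdf_smooth : forall j, smooth_on atlas setT (bdf j);
    bdf_ge0 : forall j x, 0 <= bdf j x;
    bdf_eq0 : forall j x, bdf j x = 0 <-> hyp j x;
    bdf_regular : forall j x, hyp j x -> exists h v,
      local_extension (atlas x) setT (bdf j) x h /\
      'D_v h (cmap (atlas x) x) != 0 }.

Section IndexSets.
Variable R : realType.
Implicit Type E : set (R * nat).

(* The first condition says that the exponents, if any, have a minimum and
   tend to +oo when arranged in increasing order. *)
Definition index_set E : Prop :=
  [/\ forall r : R, finite_set [set s | s <= r /\ exists p, E (s, p)],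
      forall s : R, finite_set [set p | E (s, p)],
      forall s p, E (s, p) -> E (s + 1, p) &
      forall s p, E (s, p.+1) -> E (s, p)].

Definition is_index_inf E (z : R * nat) : Prop :=
  E z /\ forall w, E w -> z.1 < w.1 \/ (z.1 = w.1 /\ (w.2 <= z.2)%N).

Definition index_inf_ge0 E : Prop :=
  forall z, is_index_inf E z -> 0 < z.1 \/ (z.1 = 0 /\ z.2 = 0%N).

End IndexSets.

Section Polyhomogeneous.
Variables (R : realType) (n : nat) (T : topologicalType).
Variable X : mfd_corners R n T.

Definition index_family (E : 'I_(nhyp X) -> set (R * nat)) : Prop :=
  forall j, index_set (E j).

(* For J a set of hypersurfaces, the relative interior of the face
   F_J = \bigcap_(j in J) F_j (with F_set0 = X). *)
Definition face_interior (J : {set 'I_(nhyp X)}) : set T :=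
  [set x | forall j, hyp j x <-> j \in J].

Definition mfd_interior : set T := face_interior finset.set0.

(* pi is a smooth retraction of the neighbourhood U of F_j onto F_j, and a
   b-map preserving the other hypersurfaces: pi^* rho_k = e * rho_k with e
   smooth and positive. Near F_j, (pi, rho_j) then identifies U with a
   neighbourhood of F_j x {0} in F_j x [0, oo[; this product decomposition is
   used to view functions on F_j as functions near F_j. It restricts to each
   face F_J. *)
Definition collar (j : 'I_(nhyp X)) (U : set T) (pi : T -> T) : Prop :=
  [/\ open U /\ hyp j `<=` U,
      smooth_map_on X U pi,
      forall x, U x -> hyp j (pi x),
      forall x, hyp j x -> pi x = x &
      forall k, k != j -> exists e : T -> R,
        smooth_on X U e /\
        forall x, U x -> 0 < e x /\ bdf k (pi x) = e x * bdf k x].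

Definition partial_expansion (E : set (R * nat)) (rho : T -> R)
    (a : R -> nat -> T -> R) (pi : T -> T) (r : R) : T -> R :=
  fun x => \sum_(z \in [set z : R * nat | E z /\ z.1 <= r])
             a z.1 z.2 (pi x) * rho x `^ z.1 * ln (rho x) ^+ z.2.

(* On the face F_J, u has at F_J :&: F_j the expansion with coefficients a.
   Vector fields on F_J tangent to its boundary are the restrictions of
   vector fields on X tangent to the boundary of X. *)
Definition has_expansion (E : set (R * nat)) (U : set T) (pi : T -> T)
    (J : {set 'I_(nhyp X)}) (j : 'I_(nhyp X)) (u : T -> R)
    (a : R -> nat -> T -> R) : Prop :=
  forall (r : R) (Vs : seq (T -> 'rV[R]_n)),
    (forall i, (i < size Vs)%N -> b_field X (nth (fun=> 0) Vs i)) ->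
  forall K : set T, compact K -> K `<=` U ->
  exists (C : R) (N : nat), forall x, K x -> face_interior J x ->
    `| foldr (lie X) (fun y => u y - partial_expansion E (bdf j) a pi r y) Vs x |
      <= C * bdf j x `^ r * (\prod_(k | k \notin (j |: J)%SET) bdf k x) ^- N.

(* Polyhomogeneous conormal functions on F_J, as functions on its relative
   interior (values elsewhere are irrelevant), by induction on the dimension
   of F_J. The boundary hypersurfaces of F_J are the components of the
   F_J :&: F_j with j \notin J; they have boundary defining function rho_j
   and index set E j. *)
Inductive phg_on_face (E : 'I_(nhyp X) -> set (R * nat))
    (U : 'I_(nhyp X) -> set T) (pi : 'I_(nhyp X) -> T -> T) :
    {set 'I_(nhyp X)} -> (T -> R) -> Prop :=
| PhgOnFace (J : {set 'I_(nhyp X)}) (u : T -> R)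
    (a : 'I_(nhyp X) -> R -> nat -> T -> R) :
    smooth_on X (face_interior J) u ->
    (forall j s p, j \notin J -> E j (s, p) ->
       phg_on_face E U pi (j |: J)%SET (a j s p)) ->
    (forall j, j \notin J -> has_expansion (E j) (U j) (pi j) J j u (a j)) ->
    phg_on_face E U pi J u.

(* The class does not depend on the choice of collars. *)
Definition phg (E : 'I_(nhyp X) -> set (R * nat)) (u : T -> R) : Prop :=
  exists (U : 'I_(nhyp X) -> set T) (pi : 'I_(nhyp X) -> T -> T),
    (forall j, collar j (U j) (pi j)) /\ phg_on_face E U pi finset.set0 u.

End Polyhomogeneous.

(* Main.v *)
(** Near F_j one has g = a_0 o pi_j + O(rho_j^s0) for some s0 > 0, where a_0 is
    the coefficient of rho_j^0 in the expansion of g. So f o g is a Taylor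
    polynomial of f at a_0 o pi_j in g - a_0 o pi_j, plus a remainder that is
    as flat as needed. The coefficients of the result are built from products
    and from the compositions of derivatives of f with a_0, to which induction
    on the dimension of the face applies: a_0 is a boundary value of g, hence
    takes its values in the compact closure of the image of g. The new index
    sets are the additive monoids generated by those of g and by (1, 0).

    The derivatives of the pulled back coefficients are never estimated one by
    one: the sum of all terms with a given exponent s is a difference of two
    remainders of g, hence O(rho_j^(s - e)) together with its b-derivatives,
    for every e > 0. Expansions are first built order by order, without
    relating the coefficients at different orders; these agree because
    coefficients are determined by the asymptotics at the boundary. *)

Require Import Defs.
From mathcomp Require Import all_boot all_order all_algebra.
From mathcomp Require Import all_classical all_reals all_analysis.
From mathcomp Require Import ring lra.

Set Implicit Arguments.
Unset Strict Implicit.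
Unset Printing Implicit Defensive.

Import Order.TTheory GRing.Theory Num.Theory.
Import numFieldNormedType.Exports.
Local Open Scope classical_set_scope.
Local Open Scope ring_scope.

(** * Smooth functions on open subsets of R^n *)

(** Bounding a pulled back coefficient by itself would require relating tangent fields near F_j to
    tangent fields on F_j through [pi j], while [has_expansion] bounds remainders only. The loss [e]
    absorbs the powers of the logarithm; it is recovered by expanding to an order strictly larger
    than the one wanted. Three obstacles shape the rest. The open set on which f is smooth need not
    be convex, so the Taylor estimate is proved for all pairs of points of a compact set, including
    those whose segment leaves the open set. The remainder must be bounded together with all its
    tangent derivatives; this works because its derivative is again made of a Taylor remainder of f'
    and of a power of g - a_0 o pi_j, with no loss of order. Finally, the bounds contain negative
    powers of the other boundary defining functions, so limits are taken at points of the relative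
    interior of the next face, along paths on which these functions stay away from zero. *)

Lemma near_eq_differentiable (R : realType) (V W : normedModType R)
    (f g : V -> W) (x : V) :
  {near x, f =1 g} -> differentiable f x -> differentiable g x.
Proof.
move=> fg /diffP[df1 df2]; apply/diffP.
apply: (@getPex _ (fun (df : {linear V -> W}) => continuous df /\
  forall y, g y = g (lim (nbhs x)) + df (y - lim (nbhs x))
                  +o_(y \near x) (y - lim (nbhs x)))).
exists 'd f x; split=> //.
have gx : g (lim (nbhs x)) = f (lim (nbhs x)).
  by rewrite lim_id //; exact/esym/(nbhs_singleton fg).
move/funext: df2 => /eqadd_some_oP df2.
suff : g = (fun y => g (lim (nbhs x)) + 'd f x (y - lim (nbhs x)))
    +o_ (nbhs x) (fun y => y - lim (nbhs x)) by move=> {1}->.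
apply/eqaddoP => e e0; have := df2 e e0.
by apply: filter_app; apply: filterS fg => y fgy /=; rewrite gx !fctE fgy.
Qed.

Lemma diff_coord (R : realType) m n (M : 'M[R]_(m, n)) i j :
  'd (fun N : 'M[R]_(m, n) => N i j : R) M = (fun N => N i j) :> (_ -> _).
Proof.
have @f : {linear 'M[R]_(m, n) -> R}.
  by exists (fun N : 'M[R]_(_, _) => N i j); do 2![eexists]; do ?[constructor];
     rewrite ?mxE// => ? *; rewrite ?mxE//; move=> ?; rewrite !mxE.
have -> : (fun N : 'M[R]_(m, n) => N i j : R) = f by [].
rewrite diff_lin //; exact: coord_continuous.
Qed.

Section SmoothOpen.
Variables (R : realType) (n : nat).
Implicit Types (O : set 'rV[R]_n) (h k : 'rV[R]_n -> R).

(** The last direction of the list is applied first, so peeling the list at its end reduces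
    smoothness of [h] to smoothness of its first derivatives. *)
Lemma smooth_openS O h : smooth_open O h <->
  (forall y, O y -> differentiable h y) /\
  forall v, smooth_open O (fun z => 'D_v h z).
Proof.
split=> [H|[H1 H2] vs].
  by split=> [|v vs y Oy]; [exact: (H [::])|rewrite -foldr_rcons; exact: H].
by case: (lastP vs) => [|s v]; [exact: H1|rewrite foldr_rcons; exact: H2].
Qed.

(** Counting derivatives makes the Leibniz and chain rules provable by induction on [m]: a
    derivative of a product or composite still contains undifferentiated factors, but these are
    needed to one order less. *)
Fixpoint smooth_order m O h : Prop :=
  (forall y, O y -> differentiable h y) /\
  if m is m'.+1 then forall v, smooth_order m' O (fun z => 'D_v h z) else True.

Lemma smooth_orderP O h : smooth_open O h <-> forall m, smooth_order m O h.
Proof.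
split=> [H m|H].
  elim: m h H => [|m IH] h /smooth_openS[H1 H2] //=.
  by split=> // v; apply: IH.
move=> vs; elim/last_ind: vs h H => [|s v IH] h H.
  by move=> y Oy; case: (H 0%N) => H0 _; exact: (H0 y Oy).
by rewrite foldr_rcons; apply: IH => m; case: (H m.+1) => _; apply.
Qed.

Lemma smooth_orderW m O h : smooth_order m.+1 O h -> smooth_order m O h.
Proof.
elim: m h => [|m IH] h [H1 H2] //=.
by split => // v; apply: IH; exact: H2.
Qed.

Lemma smooth_order_diff m O h y : smooth_order m O h -> O y -> differentiable h y.
Proof. by move=> + Oy; case: m => [|m] [H _]; exact: (H y Oy). Qed.

Lemma eq_smooth_order m O h k : open O -> (forall y, O y -> h y = k y) ->
  smooth_order m O h -> smooth_order m O k.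
Proof.
move=> oO; elim: m h k => [|m IH] h k hk [H1 H2].
  split=> // y Oy; apply: near_eq_differentiable (H1 _ Oy).
  by near=> z; apply: hk; near: z; exact: open_nbhs_nbhs.
split=> [y Oy|v].
  apply: near_eq_differentiable (H1 _ Oy).
  by near=> z; apply: hk; near: z; exact: open_nbhs_nbhs.
apply: IH (H2 v) => y Oy; apply: near_eq_derive.
by near=> z; apply: hk; near: z; exact: open_nbhs_nbhs.
Unshelve. all: by end_near. Qed.

Lemma sub_smooth_order m O O' h :
  O' `<=` O -> smooth_order m O h -> smooth_order m O' h.
Proof.
move=> sO; elim: m h => [|m IH] h [H1 H2]; split => //.
- by move=> y /sO /H1.
- by move=> y /sO /H1.
- by move=> v; exact/IH/H2.
Qed.

Lemma smooth_order_cst m O (c : R) : smooth_order m O (fun=> c).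
Proof.
elim: m c => [|m IH] c; first by split => // y _; exact: differentiable_cst.
split => [y _|v]; first exact: differentiable_cst.
rewrite (_ : (fun z => 'D_v _ z) = fun=> 0); first exact: IH.
by apply/funext => z; exact: derive_cst.
Qed.

Lemma smooth_orderD m O h k : open O ->
  smooth_order m O h -> smooth_order m O k ->
  smooth_order m O (fun z => h z + k z).
Proof.
move=> oO; elim: m h k => [|m IH] h k H K.
  split => // y Oy.
  by apply: differentiableD;
    [exact: (smooth_order_diff H)|exact: (smooth_order_diff K)].
split=> [y Oy|v].
  by apply: differentiableD;
    [exact: (smooth_order_diff H)|exact: (smooth_order_diff K)].
apply: (@eq_smooth_order _ _ (fun z => 'D_v h z + 'D_v k z)) => //.
  move=> y Oy; rewrite -deriveD //; apply: diff_derivable;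
    [exact: (smooth_order_diff H)|exact: (smooth_order_diff K)].
by apply: IH; [case: H => _; apply|case: K => _; apply].
Qed.

Lemma smooth_orderM m O h k : open O ->
  smooth_order m O h -> smooth_order m O k ->
  smooth_order m O (fun z => h z * k z).
Proof.
move=> oO; elim: m h k => [|m IH] h k H K.
  split => // y Oy.
  by apply: differentiableM;
    [exact: (smooth_order_diff H)|exact: (smooth_order_diff K)].
split=> [y Oy|v].
  by apply: differentiableM;
    [exact: (smooth_order_diff H)|exact: (smooth_order_diff K)].
apply: (@eq_smooth_order _ _ (fun z => h z * 'D_v k z + k z * 'D_v h z)) => //.
  move=> y Oy; rewrite -[_ * 'D_v k y]/(_ *: _) -[_ * 'D_v h y]/(_ *: _).
  rewrite -deriveM //; apply: diff_derivable;
    [exact: (smooth_order_diff H)|exact: (smooth_order_diff K)].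
have [[_ Hd] [_ Kd]] := (H, K).
by apply: smooth_orderD => //; apply: IH;
  first [exact: Hd|exact: Kd|exact: smooth_orderW].
Qed.

Lemma smooth_order_sum m O (I : Type) (r : seq I) (F : I -> 'rV[R]_n -> R) :
  open O -> (forall i, smooth_order m O (F i)) ->
  smooth_order m O (fun z => \sum_(i <- r) F i z).
Proof.
move=> oO H; elim: r => [|i r IH].
  under eq_fun do rewrite big_nil; exact: smooth_order_cst.
by under eq_fun do rewrite big_cons; exact: smooth_orderD.
Qed.

Lemma smooth_lineS (P : set R) (f : R -> R) :
  smooth_line P f -> smooth_line P (derive1 f).
Proof. by move=> H k x Px; have := H k.+1 x Px; rewrite derive1Sn. Qed.

Lemma smooth_line_derivable (P : set R) (f : R -> R) x :
  smooth_line P f -> P x -> derivable f x 1.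
Proof. by move=> /(_ 0%N x); apply. Qed.

Lemma smooth_line_diff (P : set R) (f : R -> R) x :
  smooth_line P f -> P x -> differentiable f x.
Proof. by move=> H Px; apply/derivable1_diffP; exact: smooth_line_derivable Px. Qed.

Lemma derive_line_comp (f : R -> R) h y v :
  differentiable h y -> differentiable f (h y) ->
  'D_v (f \o h) y = derive1 f (h y) * 'D_v h y.
Proof.
move=> dh df; rewrite !deriveE //; last exact: differentiable_comp.
rewrite diff_comp // /= deriv1E; last exact/derivable1_diffP.
by rewrite mulrC.
Qed.

Lemma smooth_order_comp_line m O (P : set R) (f : R -> R) h : open O ->
  smooth_line P f -> (forall y, O y -> P (h y)) ->
  smooth_order m O h -> smooth_order m O (f \o h).
Proof.
move=> oO + hP; elim: m f => [|m IH] f Hf H.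
  split=> // y Oy; apply: differentiable_comp; first exact: (smooth_order_diff H).
  exact: smooth_line_diff (hP _ Oy).
split=> [y Oy|v].
  apply: differentiable_comp; first exact: (smooth_order_diff H).
  exact: smooth_line_diff (hP _ Oy).
apply: (@eq_smooth_order _ _ (fun z => derive1 f (h z) * 'D_v h z)) => //.
  move=> y Oy; rewrite derive_line_comp //; first exact: (smooth_order_diff H).
  exact: smooth_line_diff (hP _ Oy).
apply: smooth_orderM => //; last by case: H => _; apply.
apply: IH; [exact: smooth_lineS|exact: smooth_orderW].
Qed.

Lemma row_differentiable (H : 'I_n -> 'rV[R]_n -> R) y :
  (forall i, differentiable (H i) y) ->
  differentiable (fun z => \row_i H i z) y.
Proof.
move=> dH.
rewrite (_ : (fun z => _) = \sum_(i < n) (fun z => H i z *: delta_mx 0 i)).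
  by apply: differentiable_sum => i; exact: differentiableZl.
apply/funext => z; rewrite fct_sumE.
rewrite [LHS](row_sum_delta); apply: eq_bigr => i _; by rewrite mxE.
Qed.

Lemma derive_row_comp h (H : 'I_n -> 'rV[R]_n -> R) y v :
  (forall i, differentiable (H i) y) -> differentiable h (\row_i H i y) ->
  'D_v (fun z => h (\row_i H i z)) y =
  \sum_(i < n) 'D_(delta_mx 0 i) h (\row_i H i y) * 'D_v (H i) y.
Proof.
move=> dH dh; have dr := row_differentiable dH.
rewrite deriveE; last exact: (@differentiable_comp _ _ _ _ (fun z => \row_i H i z) h).
rewrite (@diff_comp _ _ _ _ (fun z => \row_i H i z) h) //=.
rewrite [X in 'd h _ X]row_sum_delta linear_sum; apply: eq_bigr => i _.
rewrite linearZ /= mulrC deriveE //; congr (_ * _).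
  rewrite [in RHS](_ : H i =
    (fun M : 'rV[R]_n => M 0 i) \o (fun z => \row_i H i z)); last first.
    by apply/funext => z /=; rewrite mxE.
  rewrite diff_comp //; last exact: differentiable_coord.
  by rewrite /= diff_coord.
by rewrite deriveE.
Qed.

Lemma smooth_order_comp_row m O O' h (H : 'I_n -> 'rV[R]_n -> R) :
  open O -> smooth_open O' h -> (forall y, O y -> O' (\row_i H i y)) ->
  (forall i, smooth_order m O (H i)) ->
  smooth_order m O (fun z => h (\row_i H i z)).
Proof.
move=> oO + hO; elim: m h => [|m IH] h Hh HH.
  split=> // y Oy; apply: (@differentiable_comp _ _ _ _ (fun z => \row_i H i z) h).
    by apply: row_differentiable => i; exact: (smooth_order_diff (HH i)).
  by case/smooth_openS: Hh => Hh _; exact/Hh/hO.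
have Hd y : O y -> forall i, differentiable (H i) y.
  by move=> Oy i; exact: (smooth_order_diff (HH i)).
have [Hh1 Hh2] := (smooth_openS _ _).1 Hh.
split=> [y Oy|v].
  apply: (@differentiable_comp _ _ _ _ (fun z => \row_i H i z) h).
    exact/row_differentiable/Hd.
  exact/Hh1/hO.
apply: (@eq_smooth_order _ _ (fun z =>
  \sum_(i < n) 'D_(delta_mx 0 i) h (\row_i H i z) * 'D_v (H i) z)) => //.
  by move=> y Oy; rewrite derive_row_comp //; [exact: Hd|exact/Hh1/hO].
apply: smooth_order_sum => // i.
apply: smooth_orderM => //; last by case: (HH i) => _; apply.
apply: (IH (fun z => 'D_(delta_mx 0 i) h z)); first exact: Hh2.
by move=> j; exact: smooth_orderW.
Qed.

Lemma smooth_open_order m O h : smooth_open O h -> smooth_order m O h.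
Proof. by move=> /smooth_orderP. Qed.

Lemma sub_smooth_open O O' h :
  O' `<=` O -> smooth_open O h -> smooth_open O' h.
Proof.
by move=> sO /smooth_orderP H; apply/smooth_orderP => m; exact: sub_smooth_order (H m).
Qed.

End SmoothOpen.

(** * Smooth functions in charts *)

Section Charts.
Variables (R : realType) (n : nat) (T : topologicalType).
Implicit Types (c : corner_chart R n T) (S G : set T) (u v : T -> R).

Lemma nbhs_openP (U : topologicalType) (x : U) (P : set U) :
  nbhs x P -> exists O : set U, [/\ open O, O x & O `<=` P].
Proof. by rewrite nbhsE; case=> O [ oO xO] OP; exists O. Qed.

Lemma cmap_near c x B : cdom c x -> nbhs (cmap c x) B ->
  \forall y \near x, B (cmap c y).
Proof.
move=> cx nB; have /subspace_continuousP/(_ x cx B nB) H := @cmap_continuous _ _ _ c.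
have cd : nbhs x (cdom c) by apply: open_nbhs_nbhs; split => //; exact: cdom_open.
by apply: filterS2 cd H => y cy; apply.
Qed.

Lemma cinvK c w : (cmap c @` cdom c) w -> cmap c (cinv c w) = w.
Proof. by move=> [y cy <-]; rewrite cmapK. Qed.

Lemma cinv_near c x G : cdom c x -> nbhs x G ->
  \forall w \near cmap c x, (cmap c @` cdom c) w -> G (cinv c w).
Proof.
move=> cx nG.
have /subspace_continuousP H := @cinv_continuous _ _ _ c.
have ix : (cmap c @` cdom c) (cmap c x) by exists x.
by have := H _ ix G; rewrite /from_subspace cmapK //; apply.
Qed.

Lemma chart_nbhs c x G : cdom c x -> nbhs x G ->
  exists O : set 'rV[R]_n, [/\ open O, O (cmap c x) &
    forall y, cdom c y -> O (cmap c y) -> G y].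
Proof.
move=> cx /(cinv_near cx)/nbhs_openP[ O [ oO xO H]].
exists O; split => // y cy yO; rewrite -(cmapK cy); exact: H.
Qed.

Lemma local_extension_restrict c S u x h G (O' : set 'rV[R]_n) :
  cdom c x -> nbhs x G -> nbhs (cmap c x) O' ->
  local_extension c S u x h ->
  exists O : set 'rV[R]_n,
    [/\ open O, O (cmap c x), O `<=` O', smooth_open O h &
      forall y, cdom c y -> O (cmap c y) -> G y /\ (S y -> u y = h (cmap c y))].
Proof.
move=> cx nG nO' [ O [ oO xO sO E]].
have [ O1 [ oO1 O1x H1]] := chart_nbhs cx nG.
have [ O2 [ oO2 O2x H2]] := nbhs_openP nO'.
exists (O `&` O1 `&` O2); split => //.
- by apply: openI => //; exact: openI.
- by move=> y [_] /H2.
- by apply: sub_smooth_open sO => ? [[]].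
- by move=> y cy [[yO O1y] O2y]; split; [exact: H1|move=> Sy; exact: E].
Qed.

Lemma smooth_open_near (O : set 'rV[R]_n) h y B :
  smooth_open O h -> O y -> nbhs (h y) B -> \forall z \near y, B (h z).
Proof. by move=> /smooth_openS[H _] /H /differentiable_continuous; apply. Qed.

End Charts.

Section SmoothOn.
Variables (R : realType) (n : nat) (T : topologicalType).
Variable A : corner_atlas R n T.
Implicit Types (S G : set T) (u v : T -> R).

Lemma sub_smooth_on S S' u : S' `<=` S -> smooth_on A S u -> smooth_on A S' u.
Proof.
move=> sS H x S'x; have [h [ O [ oO xO sO E]]] := H x (sS _ S'x).
by exists h, O; split => // y cy /sS; exact: E.
Qed.

Lemma eq_smooth_on S u v : (forall x, S x -> u x = v x) ->
  smooth_on A S u -> smooth_on A S v.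
Proof.
move=> uv H x Sx; have [h [ O [ oO xO sO E]]] := H x Sx.
by exists h, O; split => // y cy Sy yO; rewrite -uv // E.
Qed.

Lemma smooth_on_cvg S u x B : smooth_on A S u -> S x -> nbhs (u x) B ->
  \forall y \near x, S y -> B (u y).
Proof.
move=> H Sx nB; have [h [ O [ oO xO sO E]]] := H x Sx.
have cx := chart_center A x.
have uxE : u x = h (cmap (A x) x) by apply: E.
rewrite uxE in nB; have nh := smooth_open_near sO xO nB.
have H1 : \forall y \near x, (B (h (cmap (A x) y)) /\ O (cmap (A x) y)).
  apply: (@cmap_near _ _ _ _ _ [set w | B (h w) /\ O w]) => //.
  by apply: filterI => //; exact: open_nbhs_nbhs.
have nc : nbhs x (cdom (A x)) by apply: open_nbhs_nbhs; split => //; exact: cdom_open.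
by apply: filterS2 nc H1 => y cy [By yO] Sy; rewrite E.
Qed.

Lemma smooth_on_cst S (c : R) : smooth_on A S (fun=> c).
Proof.
move=> x Sx; exists (fun=> c), setT; split=> //; first exact: openT.
by apply/smooth_orderP => m; exact: smooth_order_cst.
Qed.

Lemma smooth_on_op2 (op : R -> R -> R) S u v :
  (forall m (O : set 'rV[R]_n) h k, open O -> smooth_order m O h -> smooth_order m O k ->
     smooth_order m O (fun z => op (h z) (k z))) ->
  smooth_on A S u -> smooth_on A S v -> smooth_on A S (fun x => op (u x) (v x)).
Proof.
move=> Hop Hu Hv x Sx.
have [h [ O [ oO xO sO E]]] := Hu x Sx; have [k [ O' [ oO' O'x sO' E']]] := Hv x Sx.
exists (fun z => op (h z) (k z)), (O `&` O'); split => //; first exact: openI.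
  apply/smooth_orderP => m; apply: Hop; first exact: openI.
    by apply: (@sub_smooth_order _ _ _ O); [exact: subIsetl|exact: smooth_open_order].
  by apply: (@sub_smooth_order _ _ _ O'); [exact: subIsetr|exact: smooth_open_order].
by move=> y cy Sy [yO O'y]; rewrite (E y) // (E' y).
Qed.

Lemma smooth_onD S u v : smooth_on A S u -> smooth_on A S v ->
  smooth_on A S (fun x => u x + v x).
Proof. by apply: (@smooth_on_op2 (fun a b => a + b)) => *; exact: smooth_orderD. Qed.

Lemma smooth_onM S u v : smooth_on A S u -> smooth_on A S v ->
  smooth_on A S (fun x => u x * v x).
Proof. by apply: (@smooth_on_op2 (fun a b => a * b)) => *; exact: smooth_orderM. Qed.

Lemma smooth_on_sum S (I : Type) (r : seq I) (P : pred I) (F : I -> T -> R) :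
  (forall i, P i -> smooth_on A S (F i)) ->
  smooth_on A S (fun x => \sum_(i <- r | P i) F i x).
Proof.
move=> H; elim: r => [|i r IH].
  by under eq_fun do rewrite big_nil; exact: smooth_on_cst.
case Pi: (P i); under eq_fun do rewrite big_cons Pi; last exact: IH.
by apply: smooth_onD; [exact: H|exact: IH].
Qed.

Lemma smooth_onN S u : smooth_on A S u -> smooth_on A S (fun x => - u x).
Proof.
move=> H; apply: (@eq_smooth_on _ (fun x => -1 * u x)) => [x _|].
  by rewrite mulN1r.
by apply: smooth_onM => //; exact: smooth_on_cst.
Qed.

Lemma smooth_onB S u v : smooth_on A S u -> smooth_on A S v ->
  smooth_on A S (fun x => u x - v x).
Proof. by move=> Hu Hv; apply: smooth_onD => //; exact: smooth_onN. Qed.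

Lemma smooth_onX S u k : smooth_on A S u -> smooth_on A S (fun x => u x ^+ k).
Proof.
move=> H; elim: k => [|k IH].
  by under eq_fun do rewrite expr0; exact: smooth_on_cst.
by under eq_fun do rewrite exprS; exact: smooth_onM.
Qed.

Lemma open_preimage_smooth (O : set 'rV[R]_n) (P : set R) h :
  open O -> open P -> smooth_open O h -> open [set z | O z /\ P (h z)].
Proof.
move=> oO oP sO; rewrite openE => z [zO Pz] /=.
have := smooth_open_near sO zO (open_nbhs_nbhs (conj oP Pz)).
by move=> /(filterI (open_nbhs_nbhs (conj oO zO))); apply: filterS => ? [].
Qed.

Lemma smooth_on_comp_line S (P : set R) (f : R -> R) u : open P ->
  smooth_line P f -> (forall x, S x -> P (u x)) ->
  smooth_on A S u -> smooth_on A S (f \o u).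
Proof.
move=> oP Hf uP H x Sx; have [h [ O [ oO xO sO E]]] := H x Sx.
exists (f \o h), [set z | O z /\ P (h z)]; split => //.
- exact: open_preimage_smooth.
- by split => //; rewrite -E //; [exact: uP|exact: chart_center].
- apply/smooth_orderP => m; apply: (@smooth_order_comp_line _ _ _ _ P) => //.
  + exact: open_preimage_smooth.
  + by move=> y [].
  + by apply: (@sub_smooth_order _ _ _ O); [move=> ? []|exact: smooth_open_order].
- by move=> y cy Sy [yO _] /=; rewrite (E y).
Qed.

Lemma smooth_on_pullback S S' u (f : T -> T) :
  smooth_map_on A S f -> (forall x, S x -> S' (f x)) ->
  smooth_on A S' u -> smooth_on A S (u \o f).
Proof.
move=> [fc fs] fS H x Sx; have := H (f x) (fS x Sx).
set p := f x => -[h [ O [ oO Op sO E]]].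
have cp := chart_center A p.
have /(_ _) Hi i := fs p i x (conj Sx cp).
have [H' HH'] := choice Hi.
have cx := chart_center A x.
have nf : nbhs x [set y | S y -> cdom (A p) (f y)].
  have /subspace_continuousP/(_ x Sx (cdom (A p))) := fc; apply.
  by apply: open_nbhs_nbhs; split => //; exact: cdom_open.
have [ O0 [ oO0 O0x HO0]] := chart_nbhs cx nf.
have [ Oi HOi] := choice (fun i => local_extension_restrict cx nf filterT (HH' i)).
have nO : nbhs (cmap (A x) x) (O0 `&` [set z | forall i, Oi i z]).
  apply: filterI; first exact: open_nbhs_nbhs.
  apply: (@filter_forall _ _ Oi _ (nbhs_filter _)) => i; have [? ? _ _ _] := HOi i.
  exact: open_nbhs_nbhs.
have [ O1 [ oO1 O1x HO1]] := nbhs_openP nO.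
have sH i m : smooth_order m O1 (H' i).
  apply: (@sub_smooth_order _ _ _ (Oi i)); first by move=> z /HO1[_ /(_ i)].
  by apply: smooth_open_order; case: (HOi i).
have rowE y : cdom (A x) y -> O1 (cmap (A x) y) -> S y -> cdom (A p) (f y) ->
    cmap (A p) (f y) = \row_i H' i (cmap (A x) y).
  move=> cy O1y Sy cfy; apply/rowP => i; rewrite mxE.
  have [_ _ _ _ /(_ y cy ((HO1 _ O1y).2 i))[_]] := HOi i; apply; by split.
(* Off the image of the chart, the row of extensions need not be the coordinate row of any point, so
   membership in [O] has to be imposed; continuity of the row keeps [O2] open. *)
pose O2 := [set z | O1 z /\ O (\row_i H' i z)].
have cfy y : cdom (A x) y -> O1 (cmap (A x) y) -> S y -> cdom (A p) (f y).
  by move=> cy /HO1[/(HO0 y cy)]; move=> H1 _ /H1.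
have o2 : open O2.
  rewrite openE => z [ O1z zO] /=.
  have rc : {for z, continuous (fun z => \row_i H' i z)}.
    apply/differentiable_continuous/row_differentiable => i.
    exact: (smooth_order_diff (sH i 0%N)).
  have : \forall z \near z, O (\row_i H' i z) := rc _ (open_nbhs_nbhs (conj oO zO)).
  by move=> /(filterI (open_nbhs_nbhs (conj oO1 O1z))); apply: filterS => ? [].
exists (fun z => h (\row_i H' i z)), O2; split => //.
- by split => //; rewrite -rowE.
- apply/smooth_orderP => m.
  apply: (smooth_order_comp_row o2 sO); first by move=> y [].
  by move=> i; apply: (@sub_smooth_order _ _ _ O1) => // ? [].
- move=> y cy Sy [ O1y O2y] /=.
  have cf := cfy y cy O1y Sy; have fE := rowE y cy O1y Sy cf.
  by rewrite -fE E // ?fE //; exact: fS.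
Qed.

End SmoothOn.

(** * Derivatives along tangent vector fields *)

(** At a boundary point, [u \o cinv (A x)] is controlled along tangent lines only, so agreement on a
    full neighbourhood would be too much to ask. *)
Lemma eq_derive_line (R : realType) (V W : normedModType R) (f g : V -> W) a v :
  (\forall t \near (0 : R), f (t *: v + a) = g (t *: v + a)) ->
  'D_v f a = 'D_v g a.
Proof.
move=> fg; rewrite /derive.
have fga : f a = g a by have := nbhs_singleton fg; rewrite scale0r add0r.
have gf : \forall t \near (0 : R), g (t *: v + a) = f (t *: v + a).
  by apply: filterS fg => t.
congr (lim _); rewrite eqEsubset.
split; apply/near_eq_cvg/cvg_within.
- by apply: filterS gf => t E; rewrite /= E fga.
- by apply: filterS fg => t E; rewrite /= E fga.
Qed.

Section Tangent.
Variables (R : realType) (n : nat) (T : topologicalType).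
Variable A : corner_atlas R n T.
Implicit Types (S G : set T) (u v : T -> R) (x : T) (w : 'rV[R]_n).
Implicit Type V : T -> 'rV[R]_n.

Definition tangent_at x w := forall i, cmap (A x) x ord0 i = 0 -> w ord0 i = 0.

Lemma b_field_tangent V x : b_field A V -> tangent_at x (V x).
Proof. by move=> [H _] i; exact: H. Qed.

Lemma line_cvg (a w : 'rV[R]_n) B : nbhs a B ->
  \forall t \near (0 : R), B (t *: w + a).
Proof.
have c : (fun t : R => t *: w + a) @ (0 : R) --> (0 : R) *: w + a.
  by apply: cvgD; [exact: scalel_continuous|exact: cvg_cst].
by rewrite scale0r add0r in c => nB; have := c B nB.
Qed.

(** Coordinates that vanish at [x] stay zero along the line and the others stay positive for small
    [t], so the line does not leave the orthant. *)
Lemma line_image x w : tangent_at x w ->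
  \forall t \near (0 : R), (cmap (A x) @` cdom (A x)) (t *: w + cmap (A x) x).
Proof.
move=> tw; have [ O oO imE] := @cmap_image _ _ _ (A x).
have : (cmap (A x) @` cdom (A x)) (cmap (A x) x).
  by exists x => //; exact: chart_center.
rewrite imE => -[xO x0].
have H1 : \forall t \near (0 : R), O (t *: w + cmap (A x) x).
  by apply: line_cvg; exact: open_nbhs_nbhs.
have H2 : \forall t \near (0 : R), forall i, 0 <= (t *: w + cmap (A x) x) ord0 i.
  apply: (@filter_forall _ _ (fun i t => 0 <= (t *: w + cmap (A x) x) ord0 i)
    _ (nbhs_filter _)) => i.
  have := x0 i; rewrite le_eqVlt => /orP[/eqP xi|xi].
    by apply: nearW => t; rewrite !mxE -xi addr0 (tw i) ?mulr0.
  have : nbhs (cmap (A x) x) [set z | 0 < z ord0 i].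
    apply: (@coord_continuous R 1 n ord0 i (cmap (A x) x) [set r | 0 < r]).
    exact: lt_nbhsr.
  by move=> /(line_cvg w); apply: filterS => t /ltW.
by apply: filterS2 H1 H2 => t H1 H2; split.
Qed.

Lemma line_near x w G : tangent_at x w -> nbhs x G ->
  \forall t \near (0 : R), G (cinv (A x) (t *: w + cmap (A x) x)).
Proof.
move=> tw nG.
have := line_cvg w (cinv_near (chart_center A x) nG).
by apply: filterS2 (line_image tw) => t im; apply.
Qed.

(** The sets on which [lie] is determined by values inside the set. Open sets, relative interiors of
    faces and their intersections are of this kind. *)
Definition tangent_stable S := forall x w, S x -> tangent_at x w ->
  \forall t \near (0 : R), S (cinv (A x) (t *: w + cmap (A x) x)).

Lemma open_tangent_stable S : open S -> tangent_stable S.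
Proof. by move=> oS x w Sx tw; apply: line_near => //; exact: open_nbhs_nbhs. Qed.

Lemma tangent_stableI S S' :
  tangent_stable S -> tangent_stable S' -> tangent_stable (S `&` S').
Proof.
by move=> H H' x w [Sx S'x] tw; apply: filterI; [exact: H|exact: H'].
Qed.

Lemma eq_lie V S u v x : b_field A V -> tangent_stable S -> S x ->
  (forall y, S y -> u y = v y) -> lie A V u x = lie A V v x.
Proof.
move=> bV tS Sx uv; apply: eq_derive_line.
have := tS x (V x) Sx (b_field_tangent bV).
by apply: filterS => t St /=; exact: uv.
Qed.

(** Near [x] the tangent line stays in [S] and in the image of the chart, where [u] and [h] agree.
    The rules for [lie] are thereby inherited from directional derivatives in R^n. *)
Lemma lieE V S u x h : b_field A V -> tangent_stable S -> S x ->
  local_extension (A x) S u x h -> lie A V u x = 'D_(V x) h (cmap (A x) x).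
Proof.
move=> bV tS Sx [ O [ oO xO sO E]]; apply: eq_derive_line.
have tV := b_field_tangent bV (x := x).
have H1 : \forall t \near (0 : R), O (t *: V x + cmap (A x) x).
  by apply: line_cvg; exact: open_nbhs_nbhs.
near=> t.
have im : (cmap (A x) @` cdom (A x)) (t *: V x + cmap (A x) x).
  by near: t; exact: line_image.
rewrite /= E ?cinvK //.
- by case: im => y cy <-; rewrite cmapK.
- by near: t; exact: tS.
- by near: t.
Unshelve. all: by end_near. Qed.

Lemma local_extension_diff (c : corner_chart R n T) S u x h :
  local_extension c S u x h ->
  differentiable h (cmap c x).
Proof. by move=> [ O [ oO xO /smooth_openS[H _] _]]; exact: H. Qed.

Lemma lie_cst V x (c : R) : lie A V (fun=> c) x = 0.
Proof. exact: derive_cst. Qed.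

Lemma lieD V S u v x : b_field A V -> tangent_stable S -> S x ->
  smooth_on A S u -> smooth_on A S v ->
  lie A V (fun y => u y + v y) x = lie A V u x + lie A V v x.
Proof.
move=> bV tS Sx Hu Hv; have [h Hh] := Hu x Sx; have [k Hk] := Hv x Sx.
rewrite (lieE bV tS Sx Hh) (lieE bV tS Sx Hk) -deriveD; first last.
- exact/diff_derivable/(local_extension_diff Hk).
- exact/diff_derivable/(local_extension_diff Hh).
apply: (lieE bV tS Sx).
have [ O [ oO xO sO E]] := Hh; have [ O' [ oO' xO' sO' E']] := Hk.
exists (O `&` O'); split => //; first exact: openI.
  apply/smooth_orderP => m; apply: smooth_orderD; first exact: openI.
    by apply: smooth_open_order; apply: sub_smooth_open sO => ? [].
  by apply: smooth_open_order; apply: sub_smooth_open sO' => ? [].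
by move=> y cy Sy [yO yO']; rewrite (E y) // (E' y).
Qed.

Lemma lieM V S u v x : b_field A V -> tangent_stable S -> S x ->
  smooth_on A S u -> smooth_on A S v ->
  lie A V (fun y => u y * v y) x = u x * lie A V v x + v x * lie A V u x.
Proof.
move=> bV tS Sx Hu Hv; have [h Hh] := Hu x Sx; have [k Hk] := Hv x Sx.
rewrite (lieE bV tS Sx Hh) (lieE bV tS Sx Hk).
have [ O [ oO xO sO E]] := Hh; have [ O' [ oO' xO' sO' E']] := Hk.
rewrite (E x) ?(E' x) //; try exact: chart_center.
rewrite -[_ * 'D_ _ k _]/(_ *: _) -[_ * 'D_ _ h _]/(_ *: _) -deriveM; first last.
- exact/diff_derivable/(local_extension_diff Hk).
- exact/diff_derivable/(local_extension_diff Hh).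
apply: (lieE bV tS Sx).
exists (O `&` O'); split => //; first exact: openI.
  apply/smooth_orderP => m; apply: smooth_orderM; first exact: openI.
    by apply: smooth_open_order; apply: sub_smooth_open sO => ? [].
  by apply: smooth_open_order; apply: sub_smooth_open sO' => ? [].
by move=> y cy Sy [yO yO']; rewrite (E y) // (E' y).
Qed.

Lemma lie_comp_line V S (P : set R) (f : R -> R) u x : open P ->
  smooth_line P f -> (forall y, S y -> P (u y)) ->
  b_field A V -> tangent_stable S -> S x -> smooth_on A S u ->
  lie A V (f \o u) x = derive1 f (u x) * lie A V u x.
Proof.
move=> oP Hf uP bV tS Sx Hu; have [h Hh] := Hu x Sx.
rewrite (lieE bV tS Sx Hh).
have [ O [ oO xO sO E]] := Hh.
have hx : u x = h (cmap (A x) x) by apply: E => //; exact: chart_center.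
have Phx : P (h (cmap (A x) x)) by rewrite -hx; exact: uP.
rewrite hx -derive_line_comp; first last.
- exact: smooth_line_diff Phx.
- exact: local_extension_diff Hh.
apply: (lieE bV tS Sx).
exists [set z | O z /\ P (h z)]; split => //.
- exact: open_preimage_smooth.
- apply/smooth_orderP => m; apply: (@smooth_order_comp_line _ _ _ _ P) => //.
  + exact: open_preimage_smooth.
  + by move=> y [].
  + by apply: smooth_open_order; apply: sub_smooth_open sO => ? [].
- by move=> y cy Sy [yO _] /=; rewrite (E y).
Qed.

(** The value of [lie] at [y] is read in the chart centred at [y], which varies with [y]. The chain
    rule through the transition map to the fixed chart [A x] turns it into a sum of partial
    derivatives of the extension [h] times the components of [V] in [A x], and these are smooth
    since [V] is a [b_field]. *)
Lemma smooth_on_lie V S u : b_field A V -> tangent_stable S ->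
  smooth_on A S u -> smooth_on A S (lie A V u).
Proof.
move=> bV tS Hu x Sx; have [h Hh] := Hu x Sx.
have cx := chart_center A x.
have Hk i := (bV.2 x i) x cx.
have [k {}Hk] := choice Hk.
have [ Oi HOi] := choice (fun i => local_extension_restrict cx filterT filterT (Hk i)).
have [ O [ oO xO sO E]] := Hh.
have nO : nbhs (cmap (A x) x) (O `&` [set z | forall i, Oi i z]).
  apply: filterI; first exact: open_nbhs_nbhs.
  apply: (@filter_forall _ _ Oi _ (nbhs_filter _)) => i; have [? ? _ _ _] := HOi i.
  exact: open_nbhs_nbhs.
have [ O1 [ oO1 O1x HO1]] := nbhs_openP nO.
exists (fun z => \sum_(i < n) 'D_(delta_mx 0 i) h z * k i z), O1; split => //.
  apply/smooth_orderP => m; apply: smooth_order_sum => // i.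
  apply: smooth_orderM => //; apply: smooth_open_order.
    apply: (@sub_smooth_open _ _ O); first by move=> z /HO1[].
    by have [_ H] := (smooth_openS _ _).1 sO; exact: H.
  apply: (@sub_smooth_open _ _ (Oi i)); first by move=> z /HO1[].
  by have [] := HOi i.
move=> y cy Sy yO1.
have yO : O (cmap (A x) y) by have [] := HO1 _ yO1.
have cyy := chart_center A y.
(* [G] extends the transition map from the chart at [y] to the chart at [x]. *)
have [G HG] := choice (fun i => chart_compatible i cy cyy).
have GE i : G i (cmap (A y) y) = cmap (A x) y ord0 i.
  by have [ Q [_ yQ _ EQ]] := HG i; rewrite EQ.
have rowE : \row_i G i (cmap (A y) y) = cmap (A x) y.
  by apply/rowP => i; rewrite mxE GE.
have kE i : k i (cmap (A x) y) = lie A V (fun z => cmap (A x) z ord0 i) y.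
  have [_ _ _ _ /(_ y cy) H] := HOi i.
  by have [] := H ((HO1 _ yO1).2 i) => _ ->.
have tc : tangent_stable (cdom (A x)) by apply: open_tangent_stable; exact: cdom_open.
rewrite -rowE; under eq_bigr => i _.
  rewrite rowE kE (lieE bV tc cy (HG i)) -rowE; over.
rewrite -derive_row_comp; first last.
- by rewrite rowE; have [H _] := (smooth_openS _ _).1 sO; exact: H.
- by move=> i; exact: local_extension_diff (HG i).
have ncx : nbhs y (cdom (A x)) by apply: open_nbhs_nbhs; split => //; exact: cdom_open.
have [Qi HQi] := choice (fun i => local_extension_restrict cyy ncx filterT (HG i)).
have nQ : nbhs (cmap (A y) y) [set w | forall i, Qi i w].
  apply: (@filter_forall _ _ Qi _ (nbhs_filter _)) => i; have [? ? _ _ _] := HQi i.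
  exact: open_nbhs_nbhs.
apply: eq_derive_line.
have tV := b_field_tangent bV (x := y).
near=> t.
have im : (cmap (A y) @` cdom (A y)) (t *: V y + cmap (A y) y).
  by near: t; exact: line_image.
set z := cinv (A y) (t *: V y + cmap (A y) y).
have cyz : cdom (A y) z by rewrite /z; case: im => ? ? <-; rewrite cmapK.
have cxz : cdom (A x) z by rewrite /z; near: t; exact: (line_near (G := cdom (A x)) tV).
have -> : \row_i G i (t *: V y + cmap (A y) y) = cmap (A x) z.
  apply/rowP => i; rewrite mxE -(cinvK im) -/z.
  have [_ _ _ _ /(_ z cyz) H] := HQi i.
  have [|_ ->] // := H _.
  rewrite /z cinvK //; move: i {H}; near: t.
  exact: (@line_cvg _ _ [set w | forall i, Qi i w]).
rewrite /= -/z; apply: E => //.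
  by rewrite /z; near: t; exact: (tS y (V y) Sy tV).
rewrite /z; near: t; apply: (line_near (G := [set y | O (cmap (A x) y)]) tV).
by apply: cmap_near => //; exact: open_nbhs_nbhs.
Unshelve. all: by end_near. Qed.

End Tangent.

(** * Taylor remainders *)

(** [P] is monotone in the constant, so finitely many local constants can be replaced by one; the
    near-covering form of compactness, applied to the filter [+oo], does this without choosing a
    subcover. *)
Lemma compact_uniform (R : realType) (T : topologicalType) (K : set T)
    (P : R -> T -> Prop) : compact K ->
  (forall x C C', C <= C' -> P C x -> P C' x) ->
  (forall x, K x -> exists C, \forall y \near x, K y -> P C y) ->
  exists C, forall x, K x -> P C x.
Proof.
move=> /compact_near_coveringP/near_covering_withinP cK mP locP.
have : \forall C \near +oo, K `<=` P C.
  apply: cK => x Kx; have [C HC] := locP x Kx.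
  exists ([set y | K y -> P C y], [set D | C <= D]) => /=.
    by split; [exact: HC|apply: nbhs_pinfty_ge; exact: num_real].
  by move=> [y D] /= [Py CD] Ky; apply: mP CD _; exact: Py.
by move=> /filter_ex[C HC]; exists C.
Qed.

Lemma compact_bounded_fun (R : realType) (T : topologicalType) (K : set T)
    (F : T -> R) : compact K ->
  (forall x B, K x -> nbhs (F x) B -> \forall y \near x, K y -> B (F y)) ->
  exists C, forall x, K x -> `|F x| <= C.
Proof.
move=> cK cF; apply: (@compact_uniform _ _ _ (fun C x => `|F x| <= C)) => //.
  by move=> x C C' CC' /le_trans; apply.
move=> x Kx; exists (`|F x| + 1); apply: (cF x [set r | `|r| <= `|F x| + 1]) => //.
have : {for F x, continuous (fun r : R => `|r|)} by exact: norm_continuous.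
move=> /(_ [set r | r < `|F x| + 1]) H.
have : \forall r \near F x, `|r| < `|F x| + 1.
  by apply: H; apply: lt_nbhsl; rewrite ltrDl.
by apply: filterS => r /ltW.
Qed.

Section Taylor.
Variable R : realType.
Implicit Types (f : R -> R) (P : set R) (a b : R).

Lemma smooth_line_n P f i : smooth_line P f -> smooth_line P (derive1n i f).
Proof.
elim: i f => [|i IH] f Hf; first by rewrite derive1n0.
by rewrite derive1Sn; apply: IH; exact: smooth_lineS.
Qed.

Lemma derive1nZ P f c k x : open P -> smooth_line P f -> P x ->
  derive1n k (fun y => c * f y) x = c * derive1n k f x.
Proof.
move=> oP Hf; elim: k x => [|k IH] x Px; first by rewrite !derive1n0.
rewrite !derive1nS !derive1E.
rewrite (@near_eq_derive _ _ _ _ (c *: derive1n k f)).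
  by rewrite deriveZ //; exact: Hf.
by near=> y; apply: IH; near: y; exact: open_nbhs_nbhs.
Unshelve. all: by end_near. Qed.

Lemma smooth_lineZ P f c : open P -> smooth_line P f ->
  smooth_line P (fun x => c * f x).
Proof.
move=> oP Hf k x Px; apply: (@near_eq_derivable _ _ _ (c *: derive1n k f)).
  near=> y; apply/esym/(derive1nZ _ _ oP Hf); near: y; exact: open_nbhs_nbhs.
by apply: derivableZ; exact: Hf.
Unshelve. all: by end_near. Qed.

Lemma smooth_line_bounded P f K : smooth_line P f -> compact K -> K `<=` P ->
  exists C, forall x, K x -> `|f x| <= C.
Proof.
move=> Hf cK KP; apply: compact_bounded_fun => // x B Kx nB.
have /differentiable_continuous c := smooth_line_diff Hf (KP _ Kx).
have c2 : \forall y \near x, B (f y) by exact: (c B nB).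
by apply: filterS c2.
Qed.

Definition taylor_rem k f a b :=
  f b - \sum_(i < k) derive1n i f a * (b - a) ^+ i / i`!%:R.

Lemma taylor_rem0 f a b : taylor_rem 0 f a b = f b.
Proof. by rewrite /taylor_rem big_ord0 subr0. Qed.

Lemma taylor_remS k f a b : taylor_rem k.+1 f a b =
  taylor_rem k f a b - derive1n k f a * (b - a) ^+ k / k`!%:R.
Proof. by rewrite /taylor_rem big_ord_recr opprD addrA. Qed.

Lemma taylor_rem_diag k f a : taylor_rem k.+1 f a a = 0.
Proof.
rewrite /taylor_rem big_ord_recl expr0 mulr1 derive1n0 fact0 divr1.
rewrite big1 ?addr0 ?subrr //.
by move=> i _; rewrite ?subrr lift0 expr0n mulr0 mul0r.
Qed.

(** Differentiating (b - a)^i / i! in [b] shifts the index down by one, and the i-th derivative of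
    [f] at [a] is the derivative of order i - 1 of [f']. *)
Lemma is_derive_taylor_rem k f a b : derivable f b 1 ->
  is_derive b 1 (taylor_rem k.+1 f a) (taylor_rem k (derive1 f) a b).
Proof.
move=> df.
have H0 : is_derive b 1 f (derive1 f b) by rewrite derive1E; exact: derivableP.
elim: k => [|k IH].
  rewrite (_ : taylor_rem 1 f a = fun b => f b - f a).
    rewrite taylor_rem0; apply: is_derive_eq; by rewrite oppr0 addr0.
  by apply/funext => b'; rewrite /taylor_rem big_ord1 expr0 mulr1 derive1n0 fact0 divr1.
rewrite (_ : taylor_rem k.+2 f a = fun b => taylor_rem k.+1 f a b -
    (derive1n k.+1 f a / k.+1`!%:R) * (b - a) ^+ k.+1); last first.
  by apply/funext => b'; rewrite taylor_remS mulrAC.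
rewrite taylor_remS -derive1Sn.
have Hk : is_derive b 1 (fun b : R => (b - a) ^+ k.+1) (k.+1%:R * (b - a) ^+ k).
  have -> : (fun b : R => (b - a) ^+ k.+1) = (fun b => b - a) ^+ k.+1.
    by apply/funext => c; rewrite exprfctE.
  apply: is_derive_eq; by rewrite oppr0 addr0 /GRing.scale /= mulr1 mulr_natl.
apply: is_derive_eq; rewrite /GRing.scale /= factS natrM.
have : k`!%:R != 0 :> R by rewrite pnatr_eq0 -lt0n fact_gt0.
have : k.+1%:R != 0 :> R by rewrite pnatr_eq0.
move=> h1 h2; congr (_ - _); field; by rewrite h2 addrC natr1.
Qed.

(** The remainder of order [k.+1] vanishes at [b = a] and its derivative is the remainder of order
    [k] of [f'], so the mean value theorem yields one more power with the same constant. *)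
Lemma taylor_rem_segment k f P p q : p <= q -> `[p, q]%classic `<=` P ->
  smooth_line P f -> exists2 C, 0 <= C &
  forall a b, `[p, q]%classic a -> `[p, q]%classic b ->
  `|taylor_rem k f a b| <= C * `|b - a| ^+ k.
Proof.
move=> pq sP; elim: k f => [|k IH] f Hf.
  have [C HC] := smooth_line_bounded Hf (@segment_compact _ p q) sP.
  exists `|C| => // a b _ hb; rewrite taylor_rem0 expr0 mulr1.
  by rewrite (le_trans (HC b hb)) // ler_norm.
have [C C0 HC] := IH _ (smooth_lineS Hf); exists C => // a b ha hb.
have der c : `[p, q]%classic c -> is_derive c 1 (taylor_rem k.+1 f a)
    (taylor_rem k (derive1 f) a c).
  by move=> hc; apply: is_derive_taylor_rem; apply: (smooth_line_derivable Hf); exact: sP.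
(* [c] and [d] are [a] and [b] in increasing order, so that both orders share one application of the
   mean value theorem. *)
have key c d : c <= d -> `[p, q]%classic c -> `[p, q]%classic d ->
    (c = a /\ d = b) \/ (c = b /\ d = a) ->
    `|taylor_rem k.+1 f a b| <= C * `|b - a| ^+ k.+1.
  move=> cd hc hd E.
  have sub z : z \in `[c, d] -> `[p, q]%classic z.
    move: hc hd; rewrite /= !in_itv /= => /andP[? ?] /andP[? ?] /andP[? ?].
    by apply/andP; split; [exact: (@le_trans _ _ c)|exact: (@le_trans _ _ d)].
  have h1 z : z \in `]c, d[ -> is_derive z 1 (taylor_rem k.+1 f a)
      (taylor_rem k (derive1 f) a z).
    move=> zcd; apply: der; apply: sub; exact: subset_itv_oo_cc zcd.
  have h2 : {within `[c, d], continuous (taylor_rem k.+1 f a)}.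
    apply: derivable_within_continuous => z zcd.
    by have [] := der z (sub z zcd).
  have [z zcd Ez] := MVT_segment cd h1 h2.
  have : `|taylor_rem k.+1 f a b| =
     `|taylor_rem k (derive1 f) a z| * `|b - a|.
    case: E => -[E1 E2]; move: Ez; rewrite E1 E2 taylor_rem_diag.
      by rewrite subr0 => ->; rewrite normrM.
    by rewrite sub0r => /(congr1 Num.norm); rewrite normrN normrM (distrC b).
  move=> ->; rewrite exprSr mulrA ler_wpM2r //.
  apply: le_trans (HC a z ha (sub _ zcd)) _.
  have zab : `|z - a| <= `|b - a|.
    move: zcd; rewrite in_itv /=; case: E => -[-> ->] /andP[z1 z2].
      by rewrite !ger0_norm ?subr_ge0 // ?lerB //; exact: le_trans z1 z2.
    rewrite !ler0_norm ?subr_le0 //; [by rewrite lerN2 lerB|exact: le_trans z1 z2].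
  by rewrite ler_wpM2l // lerXn2r ?nnegrE.
have [ab|ba] := leP a b.
  by apply: (key a b) => //; left.
by apply: (key b a) => //; [exact: ltW|right].
Qed.

(** A crude estimate suffices for points at distance at least [e]: each Taylor term is bounded, and
    a factor |b - a| / e >= 1 supplies each missing power. The segment between the points may leave
    [P]. *)
Lemma taylor_rem_far k f P (S K : set R) (e : R) : 0 < e -> smooth_line P f ->
  compact S -> S `<=` P -> compact K -> K `<=` P ->
  exists2 C, 0 <= C & forall a b, S a -> K b -> e <= `|b - a| ->
  `|taylor_rem k f a b| <= C * `|b - a| ^+ k.
Proof.
move=> e0 Hf cS SP cK KP; elim: k => [|k [C C0 HC]].
  have [C HC] := smooth_line_bounded Hf cK KP.
  exists `|C| => // a b _ hb _; rewrite taylor_rem0 expr0 mulr1.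
  by rewrite (le_trans (HC b hb)) // ler_norm.
have [D HD] := smooth_line_bounded (smooth_line_n (i := k) Hf) cS SP.
exists ((C + `|D|) / e).
  by rewrite divr_ge0 ?addr_ge0 // ltW.
move=> a b Sa Kb eab; rewrite taylor_remS.
apply: (@le_trans _ _ ((C + `|D|) * `|b - a| ^+ k)).
  rewrite mulrDl (le_trans (ler_normB _ _)) // lerD ?HC //.
  rewrite !normrM normfV normrX -mulrA ler_pM ?mulr_ge0 ?exprn_ge0 ?invr_ge0 //.
    by rewrite (le_trans (HD a Sa)) // ler_norm.
  rewrite ler_piMr ?exprn_ge0 // invf_le1 ?normr_gt0 ?pnatr_eq0 -?lt0n ?fact_gt0 //.
  by rewrite ger0_norm // ler1n fact_gt0.
rewrite exprS mulrA ler_wpM2r ?exprn_ge0 //.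
rewrite -mulrA ler_peMr ?addr_ge0 // mulrC ler_pdivlMr // mul1r //.
Qed.

(** The segment between two points of [K] may leave [P]. Around a given point of [K], close pairs
    lie in one interval inside [P] and the other pairs are far apart; compactness makes the constant
    uniform. *)
Lemma taylor_rem_compact k f P (K : set R) : open P -> smooth_line P f ->
  compact K -> K `<=` P -> exists C, forall a b, K a -> K b ->
  `|taylor_rem k f a b| <= C * `|b - a| ^+ k.
Proof.
move=> oP Hf cK KP.
suff [C HC] : exists C, forall a, K a -> forall b, K b ->
    `|taylor_rem k f a b| <= C * `|b - a| ^+ k.
  by exists C => a b Ka; exact: HC.
apply: (@compact_uniform _ _ _
  (fun C a => forall b, K b -> `|taylor_rem k f a b| <= C * `|b - a| ^+ k)) => //.
  move=> a C C' CC' H b Kb; apply: le_trans (H b Kb) _.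
  by rewrite ler_wpM2r ?exprn_ge0.
move=> a Ka.
have [d d0 dP] : exists2 d, 0 < d & `[a - d, a + d]%classic `<=` P.
  have /nbhs_ballP[d /= d0 dP] := open_nbhs_nbhs (conj oP (KP _ Ka)).
  exists (d / 2); first by rewrite divr_gt0.
  move=> z /=; rewrite in_itv /= => /andP[z1 z2]; apply: dP.
  rewrite /ball /= ltr_distlC; apply/andP; split; lra.
have dd : a - d <= a + d by lra.
have [C C0 HC] := taylor_rem_segment k dd dP Hf.
(* Half of [d] is spent on moving [a] to [a'] and half on the distance from [a'] to [b], so that
   close pairs stay within [d] of [a]. *)
have d20 : 0 < d / 2 by rewrite divr_gt0.
have [D D0 HD] := taylor_rem_far k d20 Hf (@segment_compact _ (a - d) (a + d)) dP cK KP.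
exists (C + D); near=> a' => Ka' b Kb.
have ha' : `|a' - a| < d / 2.
  by rewrite distrC; near: a'; exact: cvgr_dist_lt.
have a'S : `[a - d, a + d]%classic a'.
  rewrite /= in_itv /=; move: ha'; rewrite ltr_distl => /andP[? ?].
  by apply/andP; split; lra.
have X0 : 0 <= `|b - a'| ^+ k by rewrite exprn_ge0.
have [far|close] := leP (d / 2) `|b - a'|.
  apply: le_trans (HD a' b a'S Kb far) _.
  by rewrite ler_wpM2r // lerDr.
apply: (@le_trans _ _ (C * `|b - a'| ^+ k)); last by rewrite ler_wpM2r // lerDl.
apply: HC => //; rewrite /= in_itv /=; move: ha' close; rewrite !ltr_distl.
by move=> /andP[? ?] /andP[? ?]; apply/andP; split; lra.
Unshelve. all: by end_near. Qed.

End Taylor.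

(** * Symbols near a boundary hypersurface *)

Section Faces.
Variables (R : realType) (n : nat) (T : topologicalType).
Variable X : mfd_corners R n T.
Implicit Types (J : {set 'I_(nhyp X)}) (j k : 'I_(nhyp X)).

Lemma bdf_cvg j x B : nbhs (bdf j x) B -> \forall y \near x, B (bdf j y).
Proof. by move=> /(smooth_on_cvg (bdf_smooth j) I); apply: filterS => y; apply. Qed.

Lemma bdf_gt0 j x : ~ hyp j x -> 0 < bdf j x.
Proof.
move=> nh; rewrite lt_neqAle bdf_ge0 andbT; apply/eqP => E; apply: nh.
by apply/bdf_eq0.
Qed.

Lemma not_hyp_near j x : ~ hyp j x -> \forall y \near x, ~ hyp j y.
Proof.
move=> /bdf_gt0 h; have := bdf_cvg (lt_nbhsr h).
by apply: filterS => y; move=> /[swap] /bdf_eq0 ->; rewrite ltxx.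
Qed.

(** By embeddedness a hypersurface through [x] is the zero set of one coordinate, which vanishes at
    [x] and hence along the tangent line; the other hypersurfaces miss a neighbourhood of [x]. *)
Lemma face_tangent_stable J : tangent_stable X (face_interior J).
Proof.
move=> x w Jx tw.
apply: (@filter_forall _ _
  (fun j t => hyp j (cinv (X x) (t *: w + cmap (X x) x)) <-> j \in J)
   _ (nbhs_filter _)) => j.
have [hx|nhx] := pselect (hyp j x).
  have jJ : j \in J by apply/Jx.
  have [i Hi] := hyp_embedded hx.
  have xi : cmap (X x) x ord0 i = 0 by have [_ [H _]] := nbhs_singleton Hi; exact: H.
  have := line_near tw Hi; apply: filterS2 (line_image tw) => t im [_ E].
  split=> // _; apply/E; rewrite cinvK // !mxE xi addr0 (tw i xi); exact: mulr0.
have jJ : ~ (j \in J) by move=> /Jx.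
have := line_near tw (not_hyp_near nhx).
by apply: filterS => t H; split => [/H|/jJ].
Qed.

Lemma face_bdf_gt0 J j x : face_interior J x -> j \notin J -> 0 < bdf j x.
Proof. by move=> Jx jJ; apply: bdf_gt0 => /Jx; apply/negP. Qed.

(** The weight whose negative powers are allowed in [has_expansion]. *)
Definition rest_bdf J j x := \prod_(k | k \notin (j |: J)%SET) bdf k x.

Lemma rest_bdf_gt0 J j x : face_interior J x -> 0 < rest_bdf J j x.
Proof.
move=> Jx; apply: prodr_gt0 => k kJ; apply: (face_bdf_gt0 Jx).
by move: kJ; rewrite !inE negb_or => /andP[].
Qed.

Lemma compact_smooth_bounded (K : set T) u : compact K -> smooth_on X setT u ->
  exists C, forall x, K x -> `|u x| <= C.
Proof.
move=> cK Hu; apply: compact_bounded_fun => // x B Kx nB.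
by have := smooth_on_cvg Hu I nB; apply: filterS => y H _; exact: H.
Qed.

Lemma smooth_on_rest_bdf J j : smooth_on X setT (rest_bdf J j).
Proof.
rewrite /rest_bdf; elim: (index_enum _) => [|k s IH].
  by under eq_fun do rewrite big_nil; exact: smooth_on_cst.
case Pk: (k \notin (j |: J)%SET); under eq_fun do rewrite big_cons Pk; last exact: IH.
by apply: smooth_onM => //; exact: bdf_smooth.
Qed.

Lemma compact_bdf_bounded (K : set T) J j : compact K ->
  exists2 D, 1 <= D & forall x, K x -> bdf j x <= D /\ rest_bdf J j x <= D.
Proof.
move=> cK; have [C1 H1] := compact_smooth_bounded cK (bdf_smooth j).
have [C2 H2] := compact_smooth_bounded cK (smooth_on_rest_bdf J j).
exists (Num.max 1 (Num.max C1 C2)); first by rewrite le_max lexx.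
move=> x Kx; rewrite !le_max.
by rewrite (le_trans (ler_norm _) (H1 x Kx)) (le_trans (ler_norm _) (H2 x Kx)) !orbT.
Qed.

Variable U : 'I_(nhyp X) -> set T.
Hypothesis oU : forall j, open (U j).

Definition collar_face J j := face_interior J `&` U j.

Lemma collar_face_stable J j : tangent_stable X (collar_face J j).
Proof.
by apply: tangent_stableI; [exact: face_tangent_stable|exact: open_tangent_stable].
Qed.

Section Symbols.
Variables (J : {set 'I_(nhyp X)}) (j : 'I_(nhyp X)).
Hypothesis jJ : j \notin J.
Implicit Types (u v : T -> R) (V : T -> 'rV[R]_n) (r : R).

Let W := collar_face J j.
Let rho := bdf j.
Let q := rest_bdf J j.
Let tW : tangent_stable X W := @collar_face_stable J j.

Let rho_gt0 x : W x -> 0 < rho x.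
Proof. by move=> [Jx _]; exact: face_bdf_gt0 Jx jJ. Qed.

Let q_gt0 x : W x -> 0 < q x.
Proof. by move=> [Jx _]; exact: rest_bdf_gt0. Qed.

Definition growth r u := forall K : set T, compact K -> K `<=` U j ->
  exists (C : R) (N : nat), forall x, K x -> face_interior J x ->
    `|u x| <= C * rho x `^ r * q x ^- N.

(** The weight is bounded on compact sets, so its exponent can be raised at the expense of the
    constant. This brings two bounds to a common exponent before they are added. *)
Lemma growthP r u K : growth r u -> compact K -> K `<=` U j ->
  exists N0, forall N, (N0 <= N)%N -> exists2 C, 0 <= C &
    forall x, K x -> face_interior J x -> `|u x| <= C * rho x `^ r * q x ^- N.
Proof.
move=> H cK KU; have [C [N0 HC]] := H K cK KU.
have [D D1 HD] := compact_bdf_bounded J j cK.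
exists N0 => N N0N; exists (`|C| * D ^+ (N - N0)).
  by rewrite mulr_ge0 // exprn_ge0 // (le_trans _ D1).
move=> x Kx Jx; have Wx : W x by split => //; exact: KU.
have q0 := q_gt0 Wx.
apply: le_trans (HC x Kx Jx) _.
rewrite (_ : _ * D ^+ _ * _ * _ = `|C| * rho x `^ r * q x ^- N0 *
    (D ^+ (N - N0) * q x ^- (N - N0))); last first.
  by rewrite -{2}(subnK N0N) exprD invfM; ring.
have B0 : 0 <= rho x `^ r * q x ^- N0.
  by rewrite mulr_ge0 ?powR_ge0 // invr_ge0 exprn_ge0 // ltW.
apply: (@le_trans _ _ (`|C| * rho x `^ r * q x ^- N0)).
  by rewrite -!mulrA ler_wpM2r ?ler_norm.
rewrite ler_peMr //; first by rewrite -mulrA mulr_ge0.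
rewrite ler_pdivlMr ?exprn_gt0 // mul1r lerXn2r ?nnegrE //.
- exact: ltW.
- exact: le_trans D1.
- by have [_] := HD x Kx.
Qed.

Lemma eq_growth r u v : (forall x, W x -> u x = v x) -> growth r u -> growth r v.
Proof.
move=> uv H K cK KU; have [C [N HC]] := H K cK KU; exists C, N => x Kx Jx.
by rewrite -uv; [exact: HC|split => //; exact: KU].
Qed.

Lemma growthD r u v : growth r u -> growth r v -> growth r (fun x => u x + v x).
Proof.
move=> Hu Hv K cK KU; have [N1 H1] := growthP Hu cK KU.
have [N2 H2] := growthP Hv cK KU.
have [C1 _ HC1] := H1 _ (leq_maxl N1 N2); have [C2 _ HC2] := H2 _ (leq_maxr N1 N2).
exists (C1 + C2), (maxn N1 N2) => x Kx Jx.
by rewrite (le_trans (ler_normD _ _)) // !mulrDl lerD // ?HC1 ?HC2.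
Qed.

Lemma growthM r r' u v : growth r u -> growth r' v ->
  growth (r + r') (fun x => u x * v x).
Proof.
move=> Hu Hv K cK KU; have [C1 [N1 H1]] := Hu K cK KU.
have [C2 [N2 H2]] := Hv K cK KU.
exists (C1 * C2), (N1 + N2)%N => x Kx Jx.
have Wx : W x by split => //; exact: KU.
rewrite normrM powRD; last by rewrite implybE (gt_eqF (rho_gt0 Wx)) orbT.
rewrite exprD invfM.
rewrite [leRHS](_ : _ = (C1 * rho x `^ r * q x ^- N1) *
  (C2 * rho x `^ r' * q x ^- N2)); last by ring.
by rewrite ler_pM // ?H1 ?H2.
Qed.

Lemma le_growth r r' u : r' <= r -> growth r u -> growth r' u.
Proof.
move=> rr' H K cK KU; have [N0 HN] := growthP H cK KU.
have [C C0 HC] := HN _ (leqnn N0).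
have [D D1 HD] := compact_bdf_bounded J j cK.
exists (C * D `^ (r - r')), N0 => x Kx Jx.
have Wx : W x by split => //; exact: KU.
apply: le_trans (HC x Kx Jx) _.
have q0 : 0 <= q x ^- N0 by rewrite invr_ge0 exprn_ge0 // ltW // q_gt0.
rewrite ler_wpM2r // -mulrA ler_wpM2l //.
have -> : rho x `^ r = rho x `^ (r - r') * rho x `^ r'.
  by rewrite -powRD ?subrK // implybE (gt_eqF (rho_gt0 Wx)) orbT.
rewrite ler_wpM2r ?powR_ge0 //.
apply: ge0_ler_powR; rewrite ?nnegrE ?subr_ge0 // ?bdf_ge0 //.
- exact: le_trans D1.
- by have [] := HD x Kx.
Qed.

Lemma bounded_growth C u : (forall x, W x -> `|u x| <= C) -> growth 0 u.
Proof.
move=> H K cK KU; exists C, 0%N => x Kx Jx.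
by rewrite powRr0 expr0 invr1 !mulr1; apply: H; split => //; exact: KU.
Qed.

(** Conormal functions of order [r], with [m] tangent derivatives under control. Smoothness is part
    of each level because the Leibniz rule for [lie] uses it. *)
Fixpoint symbol m r u : Prop :=
  [/\ smooth_on X W u, growth r u &
    if m is m'.+1 then forall V, b_field X V -> symbol m' r (lie X V u) else True].

Lemma symbol_smooth m r u : symbol m r u -> smooth_on X W u.
Proof. by case: m => [|m] []. Qed.

Lemma symbol_growth m r u : symbol m r u -> growth r u.
Proof. by case: m => [|m] []. Qed.

Lemma eq_symbol m r u v : (forall x, W x -> u x = v x) ->
  symbol m r u -> symbol m r v.
Proof.
elim: m u v => [|m IH] u v uv [Hu Gu Lu]; split => //;
  try exact: eq_smooth_on uv Hu; try exact: eq_growth uv Gu.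
move=> V bV; apply: IH (Lu V bV) => x Wx; exact: eq_lie bV tW Wx uv.
Qed.

Lemma symbol_pred m r u : symbol m.+1 r u -> symbol m r u.
Proof.
elim: m u => [|m IH] u [Hu Gu Lu]; split => //.
by move=> V bV; apply: IH; exact: Lu.
Qed.

Lemma le_symbol m r r' u : r' <= r -> symbol m r u -> symbol m r' u.
Proof.
move=> rr'; elim: m u => [|m IH] u [Hu Gu Lu]; split => //; try exact: le_growth rr' Gu.
by move=> V bV; apply: IH; exact: Lu.
Qed.

Lemma symbol_cst m (c : R) : symbol m 0 (fun=> c).
Proof.
have G d : growth 0 (fun=> d) by apply: (@bounded_growth `|d|).
elim: m c => [|m IH] c; split => //; try exact: smooth_on_cst.
move=> V bV; apply: eq_symbol (IH 0) => x _; by rewrite lie_cst.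
Qed.

Lemma symbol0 m r : symbol m r (fun=> 0).
Proof.
have G : growth r (fun=> 0).
  by move=> K cK KU; exists 0, 0%N => x _ _; rewrite !mul0r normr0.
elim: m => [|m IH]; split => //; try exact: smooth_on_cst.
move=> V bV; apply: eq_symbol IH => x _; by rewrite lie_cst.
Qed.

Lemma symbolD m r u v : symbol m r u -> symbol m r v ->
  symbol m r (fun x => u x + v x).
Proof.
elim: m u v => [|m IH] u v [Hu Gu Lu] [Hv Gv Lv]; split => //;
  try exact: smooth_onD; try exact: growthD.
move=> V bV; apply: eq_symbol (IH _ _ (Lu V bV) (Lv V bV)) => x Wx.
by rewrite (lieD bV tW).
Qed.

Lemma symbolM m r r' u v : symbol m r u -> symbol m r' v ->
  symbol m (r + r') (fun x => u x * v x).
Proof.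
elim: m r r' u v => [|m IH] r r' u v Hu Hv.
  case: Hu Hv => [Hu Gu _] [Hv Gv _]; split => //; [exact: smooth_onM|exact: growthM].
have [Su Gu Lu] := Hu; have [Sv Gv Lv] := Hv.
split; [exact: smooth_onM|exact: growthM|move=> V bV].
apply: (@eq_symbol _ _ (fun x => u x * lie X V v x + v x * lie X V u x)).
  by move=> x Wx; rewrite (lieM bV tW).
apply: symbolD.
  by apply: IH; [exact: symbol_pred|exact: Lv].
by rewrite addrC; apply: IH; [exact: symbol_pred|exact: Lu].
Qed.

(** For p > 0 the function rho^s log^p rho is O(rho^(s - e)) for every e > 0 but not O(rho^s).
    Orders taken with this loss still add under products, by halving [e]. *)
Definition near_symbol m r u := forall e, 0 < e -> symbol m (r - e) u.

Lemma symbol_near m r u : symbol m r u -> near_symbol m r u.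
Proof. by move=> H e e0; apply: le_symbol H; rewrite gerBl ltW. Qed.

Lemma near_symbol_lt m r r' u : r' < r -> near_symbol m r u -> symbol m r' u.
Proof.
move=> rr' H; have := H (r - r'); rewrite subr_gt0 opprB addrC subrK; exact.
Qed.

Lemma le_near_symbol m r r' u : r' <= r -> near_symbol m r u -> near_symbol m r' u.
Proof.
move=> rr' H e e0; apply: near_symbol_lt H.
by rewrite ltrBlDr (le_lt_trans rr') // ltrDl.
Qed.

Lemma near_symbol_smooth m r u : near_symbol m r u -> smooth_on X W u.
Proof. by move=> /(_ 1 ltr01) /symbol_smooth. Qed.

Lemma eq_near_symbol m r u v : (forall x, W x -> u x = v x) ->
  near_symbol m r u -> near_symbol m r v.
Proof. by move=> uv H e e0; exact: eq_symbol uv (H e e0). Qed.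

Lemma near_symbol_pred m r u : near_symbol m.+1 r u -> near_symbol m r u.
Proof. by move=> H e /H; exact: symbol_pred. Qed.

Lemma near_symbol_lie m r u V : b_field X V ->
  near_symbol m.+1 r u -> near_symbol m r (lie X V u).
Proof. by move=> bV H e /H[_ _]; apply. Qed.

Lemma near_symbol_cst m c : near_symbol m 0 (fun=> c).
Proof. exact/symbol_near/symbol_cst. Qed.

Lemma near_symbolD m r u v : near_symbol m r u -> near_symbol m r v ->
  near_symbol m r (fun x => u x + v x).
Proof. by move=> Hu Hv e e0; apply: symbolD; [exact: Hu|exact: Hv]. Qed.

Lemma near_symbolM m r r' u v : near_symbol m r u -> near_symbol m r' v ->
  near_symbol m (r + r') (fun x => u x * v x).
Proof.
move=> Hu Hv e e0; have e2 : 0 < e / 2 by rewrite divr_gt0.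
rewrite (_ : r + r' - e = (r - e / 2) + (r' - e / 2)); last by lra.
by apply: symbolM; [exact: Hu|exact: Hv].
Qed.

Lemma near_symbolZ m r c u : near_symbol m r u -> near_symbol m r (fun x => c * u x).
Proof.
move=> H; rewrite -[r]add0r.
by apply: near_symbolM => //; exact: near_symbol_cst.
Qed.

Lemma near_symbolB m r u v : near_symbol m r u -> near_symbol m r v ->
  near_symbol m r (fun x => u x - v x).
Proof.
move=> Hu Hv; apply: near_symbolD => //.
by apply: eq_near_symbol (near_symbolZ (-1) Hv) => x _; rewrite mulN1r.
Qed.

Lemma near_symbolX m r (k : nat) u : near_symbol m r u ->
  near_symbol m (k%:R * r) (fun x => u x ^+ k).
Proof.
move=> H; elim: k => [|k IH].
  by rewrite mul0r; under eq_fun do rewrite expr0; exact: near_symbol_cst.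
rewrite -natr1 addrC mulrDl mul1r; under eq_fun do rewrite exprS.
exact: near_symbolM.
Qed.

Variables (O K : set R).
Hypotheses (oO : open O) (cK : compact K) (KO : K `<=` O).

(** As [u] stays in the compact set [K], each derivative of [f] is bounded along [u], and V (f o u)
    = (f' o u) V u reduces to [f'] with one derivative less. At order 0 this product keeps its
    order. *)
Lemma near_symbol_comp_line m f u : smooth_line O f ->
  (forall x, W x -> K (u x)) -> near_symbol m 0 u -> near_symbol m 0 (f \o u).
Proof.
move=> + Ku; elim: m f => [|m IH] f Hf Hu.
  move=> e e0; apply: (@le_symbol _ 0); first by rewrite gerBl ltW.
  split => //.
    apply: (smooth_on_comp_line oO Hf); first by move=> x /Ku /KO.
    exact: near_symbol_smooth Hu.
  have [C HC] := smooth_line_bounded Hf cK KO.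
  by apply: (@bounded_growth C) => x /Ku; exact: HC.
have Su := near_symbol_smooth Hu.
have uO x : W x -> O (u x) by move=> /Ku/KO.
move=> e e0; split.
- exact: (smooth_on_comp_line oO Hf).
- apply: (@le_growth 0); first by rewrite gerBl ltW.
  have [C HC] := smooth_line_bounded Hf cK KO.
  by apply: (@bounded_growth C) => x /Ku; exact: HC.
- move=> V bV; suff : near_symbol m 0 (lie X V (f \o u)) by apply.
  apply: (@eq_near_symbol _ _ (fun x => (derive1 f \o u) x * lie X V u x)).
    by move=> x Wx; rewrite (lie_comp_line oO Hf uO bV tW Wx Su).
  rewrite -[0]addr0; apply: near_symbolM; last exact: near_symbol_lie.
  by apply: IH; [exact: smooth_lineS|exact: near_symbol_pred].
Qed.

End Symbols.
End Faces.

(** * Lie derivatives and conormal bounds of Taylor remainders *)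

Section LieTaylor.
Variables (R : realType) (n : nat) (T : topologicalType).
Variables (A : corner_atlas R n T) (V : T -> 'rV[R]_n) (S : set T).
Hypotheses (bV : b_field A V) (tS : tangent_stable A S).
Implicit Types (u v a : T -> R) (f : R -> R).

Lemma lieZ c u x : S x -> smooth_on A S u ->
  lie A V (fun y => c * u y) x = c * lie A V u x.
Proof.
move=> Sx Hu; rewrite (lieM bV tS Sx) //; last exact: smooth_on_cst.
by rewrite lie_cst mulr0 addr0.
Qed.

Lemma lieB u v x : S x -> smooth_on A S u -> smooth_on A S v ->
  lie A V (fun y => u y - v y) x = lie A V u x - lie A V v x.
Proof.
move=> Sx Hu Hv; under [X in lie _ _ X]eq_fun do rewrite -mulN1r.
rewrite (lieD bV tS Sx) //; first by rewrite lieZ // mulN1r.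
by apply: smooth_onM => //; exact: smooth_on_cst.
Qed.

Lemma lieX u x i : S x -> smooth_on A S u ->
  lie A V (fun y => u y ^+ i.+1) x = i.+1%:R * u x ^+ i * lie A V u x.
Proof.
move=> Sx Hu; elim: i => [|i IH].
  by under eq_fun do rewrite expr1; rewrite expr0 mulr1 mul1r.
under eq_fun do rewrite exprS.
rewrite (lieM bV tS Sx) //; last exact: smooth_onX.
by rewrite IH -(natr1 i.+1) exprS; ring.
Qed.

Variables (O : set R) (a u : T -> R).
Hypothesis oO : open O.
Hypotheses (aO : forall x, S x -> O (a x)) (uO : forall x, S x -> O (u x)).
Hypotheses (Sa : smooth_on A S a) (Su : smooth_on A S u).

Lemma smooth_on_taylor_rem k f : smooth_line O f ->
  smooth_on A S (fun x => taylor_rem k f (a x) (u x)).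
Proof.
move=> Hf; apply: smooth_onB; first exact: (smooth_on_comp_line oO Hf).
apply: smooth_on_sum => i _; apply: smooth_onM; last exact: smooth_on_cst.
apply: smooth_onM; last by apply: smooth_onX; exact: smooth_onB.
exact: (smooth_on_comp_line oO (smooth_line_n (i := i) Hf)).
Qed.

(** Differentiating in the second argument gives the remainder of [f']. Differentiating in the base
    point telescopes, and only the contribution of the last Taylor term survives. *)
Lemma lie_taylor_rem k f x : S x -> smooth_line O f ->
  lie A V (fun y => taylor_rem k.+1 f (a y) (u y)) x =
  taylor_rem k (derive1 f) (a x) (u x) * lie A V u x -
  derive1n k.+1 f (a x) * (u x - a x) ^+ k / k`!%:R * lie A V a x.
Proof.
move=> Sx Hf; elim: k => [|k IH].
  rewrite (_ : (fun y => _) = fun y => (f \o u) y - (f \o a) y); last first.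
    apply/funext => y; rewrite /taylor_rem big_ord1 expr0 mulr1.
    by rewrite derive1n0 fact0 divr1.
  rewrite lieB //; try exact: (smooth_on_comp_line oO Hf).
  rewrite (lie_comp_line oO Hf uO bV tS Sx Su) (lie_comp_line oO Hf aO bV tS Sx Sa).
  by rewrite taylor_rem0 expr0 fact0 mulr1 divr1 derive1n1.
have Hk := smooth_line_n (i := k.+1) Hf.
have Sk : smooth_on A S (derive1n k.+1 f \o a) by exact: (smooth_on_comp_line oO Hk).
have Sw : smooth_on A S (fun y => u y - a y) by exact: smooth_onB.
rewrite (_ : (fun y => _) = fun y => taylor_rem k.+1 f (a y) (u y) -
    (k.+1)`!%:R^-1 * ((derive1n k.+1 f \o a) y * (u y - a y) ^+ k.+1)); last first.
  by apply/funext => y; rewrite taylor_remS /=; congr (_ - _); rewrite mulrC.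
have SM : smooth_on A S (fun y => (derive1n k.+1 f \o a) y * (u y - a y) ^+ k.+1).
  by apply: smooth_onM => //; exact: smooth_onX.
rewrite lieB //; first last.
- by apply: smooth_onM => //; exact: smooth_on_cst.
- exact: smooth_on_taylor_rem.
rewrite IH lieZ // (lieM bV tS Sx) //; last exact: smooth_onX.
rewrite (lieX _ Sx Sw) (lieB Sx) // (lie_comp_line oO Hk aO bV tS Sx Sa).
rewrite taylor_remS -derive1Sn -derive1nS /= factS natrM.
have h1 : k`!%:R != 0 :> R by rewrite pnatr_eq0 -lt0n fact_gt0.
have h2 : k.+1%:R != 0 :> R by rewrite pnatr_eq0.
field; by rewrite h1 addrC natr1.
Qed.

End LieTaylor.

Section SymbolTaylor.
Variables (R : realType) (n : nat) (T : topologicalType).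
Variable X : mfd_corners R n T.
Variable U : 'I_(nhyp X) -> set T.
Hypothesis oU : forall j, open (U j).
Variables (J : {set 'I_(nhyp X)}) (j : 'I_(nhyp X)).
Hypothesis jJ : j \notin J.
Variables (O K : set R) (a u : T -> R) (s : R).
Hypotheses (oO : open O) (cK : compact K) (KO : K `<=` O).
Let W := collar_face U J j.
Hypotheses (aK : forall x, W x -> K (a x)) (uK : forall x, W x -> K (u x)).
Hypothesis a0 : forall m, near_symbol U J j m 0 a.
Hypothesis u0 : forall m, near_symbol U J j m 0 u.
Hypothesis ua : forall m, near_symbol U J j m s (fun x => u x - a x).

Lemma growth_taylor_rem k f e : 0 < e -> smooth_line O f ->
  growth U J j (k%:R * s - e) (fun x => taylor_rem k f (a x) (u x)).
Proof.
move=> e0 Hf K' cK' K'U.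
have [C HC] := taylor_rem_compact k oO Hf cK KO.
have H : growth U J j (k%:R * s - e) (fun x => C * (u x - a x) ^+ k).
  apply: (@symbol_growth _ _ _ _ _ _ _ 0); apply: near_symbolZ => //.
  exact: near_symbolX.
have [C' [N HC']] := H K' cK' K'U; exists C', N => x Kx Jx.
have Wx : W x by split => //; exact: K'U.
apply: le_trans (HC' x Kx Jx).
apply: le_trans (HC (a x) (u x) (aK Wx) (uK Wx)) _.
by rewrite -normrX (le_trans (ler_norm _)) // normrM [in leRHS]normrM normr_id.
Qed.

Lemma near_symbol_taylor_rem m k f : smooth_line O f ->
  near_symbol U J j m (k%:R * s) (fun x => taylor_rem k f (a x) (u x)).
Proof.
have aO x : W x -> O (a x) by move=> /aK/KO.
have uO x : W x -> O (u x) by move=> /uK/KO.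
have Sa := near_symbol_smooth (a0 0%N); have Su := near_symbol_smooth (u0 0%N).
have tW := @collar_face_stable _ _ _ _ _ oU J j.
elim: m k f => [|m IH] k f Hf e e0.
  by split => //; [exact: (smooth_on_taylor_rem oO)|exact: growth_taylor_rem].
split; [exact: (smooth_on_taylor_rem oO)|exact: growth_taylor_rem|].
move=> V bV; suff : near_symbol U J j m (k%:R * s)
  (lie X V (fun x => taylor_rem k f (a x) (u x))) by apply.
case: k => [|k].
  rewrite mul0r; under [X in lie _ _ X]eq_fun do rewrite taylor_rem0.
  by apply: near_symbol_lie => //; exact: (near_symbol_comp_line oU jJ oO cK KO Hf uK).
(* Taken separately, the two terms of [lie_taylor_rem] are only known to have order k s, while (k +
   1) s is wanted. Moving the Taylor term of degree [k] of [f'] from the first to the second makes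
   the second a multiple of V (u - a), which contributes the missing [s]. *)
apply: (@eq_near_symbol _ _ _ _ _ oU _ _ _ _
  (fun x => taylor_rem k.+1 (derive1 f) (a x) (u x) * lie X V u x +
   ((k`!%:R^-1 * (derive1n k.+1 f \o a) x) * (u x - a x) ^+ k) *
     lie X V (fun y => u y - a y) x)).
  move=> x Wx; rewrite (lie_taylor_rem bV tW oO aO uO Sa Su k Wx Hf).
  rewrite (lieB bV tW Wx) // taylor_remS -derive1Sn /=; ring.
apply: near_symbolD => //.
  rewrite -[_ * s]addr0; apply: near_symbolM => //.
    by apply: IH; exact: smooth_lineS.
  exact: near_symbol_lie.
rewrite -natr1 mulrDl mul1r; apply: near_symbolM => //; last exact: near_symbol_lie.
rewrite -[_ * s]add0r; apply: near_symbolM => //; last exact: near_symbolX.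
apply: near_symbolZ => //.
exact: (near_symbol_comp_line oU jJ oO cK KO (smooth_line_n (i := k.+1) Hf) aK).
Qed.

End SymbolTaylor.

(** * Limits at the boundary *)

Section BoundaryFilter.
Variables (R : realType) (n : nat) (T : topologicalType).
Variable X : mfd_corners R n T.
Variables (U : 'I_(nhyp X) -> set T) (pi : 'I_(nhyp X) -> T -> T).
Hypothesis hcol : forall j, collar j (U j) (pi j).
Implicit Types (J : {set 'I_(nhyp X)}) (j k : 'I_(nhyp X)).

Lemma collar_open j : open (U j).
Proof. by have [[]] := hcol j. Qed.

Lemma hyp_collar j x : hyp j x -> U j x.
Proof. by have [[_ H] _ _ _ _] := hcol j; exact: H. Qed.

Lemma collar_retract j x : hyp j x -> pi j x = x.
Proof. by have [_ _ _ H _] := hcol j; exact: H. Qed.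

Lemma collar_retract_near j y B : hyp j y -> nbhs y B ->
  \forall x \near y, B (pi j x).
Proof.
move=> hy nB; have [_ [/subspace_continuousP cp _] _ _ _] := hcol j.
have Uy := hyp_collar hy.
have : nbhs (pi j y) B by rewrite collar_retract.
move=> /(cp y Uy) H; have nU : nbhs y (U j).
  by apply: open_nbhs_nbhs; split => //; exact: collar_open.
by apply: filterS2 nU H => x Ux; apply.
Qed.

(** [pi j] multiplies the other boundary defining functions by positive factors, so it neither
    creates nor destroys their zeros. *)
Lemma collar_retract_face J j x : j \notin J -> collar_face U J j x ->
  face_interior (j |: J)%SET (pi j x).
Proof.
move=> jJ [Jx Ux] k; have [_ _ hp _ he] := hcol j.
rewrite !inE; have [->|kj] := eqVneq k j; first by split => // _; exact: hp.
rewrite orFb; have [e [_ /(_ x Ux)[e0 E]]] := he k kj.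
split; first move=> /bdf_eq0; rewrite ?E.
  move=> /eqP; rewrite mulf_eq0 (gt_eqF e0) /= => /eqP /bdf_eq0.
  by move=> /Jx.
move=> /Jx /bdf_eq0 H; apply/bdf_eq0; by rewrite E H mulr0.
Qed.

Lemma collar_pullback_smooth J j u : j \notin J ->
  smooth_on X (face_interior (j |: J)%SET) u ->
  smooth_on X (collar_face U J j) (u \o pi j).
Proof.
move=> jJ; apply: smooth_on_pullback; last by move=> x; exact: collar_retract_face.
have [_ [cp sp] _ _ _] := hcol j; split.
  by apply: continuous_subspaceW cp => x [].
move=> p i; apply: sub_smooth_on (sp p i) => x [[_ ?] ?]; by split.
Qed.

Section Path.
Variables (J : {set 'I_(nhyp X)}) (j : 'I_(nhyp X)) (y : T).
Hypotheses (jJ : j \notin J) (hy : face_interior (j |: J)%SET y).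

Let hjy : hyp j y.
Proof. by apply/hy; rewrite !inE eqxx. Qed.

Let c := X y.
Variable i : 'I_n.
Hypothesis Hi : \forall z \near y, cdom c z /\ (hyp j z <-> cmap c z ord0 i = 0).

(** The half-line that leaves F_j in the coordinate defining it. For small t > 0 it enters the
    relative interior of F_J, since the other hypersurfaces through [y] are cut out by coordinates
    that stay zero. *)
Let l (t : R) : 'rV[R]_n := t *: delta_mx 0 i + cmap c y.
Let g (t : R) : T := cinv c (l t).

Let l_cvg : forall t B, nbhs (l t) B -> \forall t' \near t, B (l t').
Proof.
move=> t B nB; have H : l @ t --> l t.
  by apply: cvgD; [exact: scalel_continuous|exact: cvg_cst].
exact: (H B nB).
Qed.

Let l0 : l 0 = cmap c y.
Proof. by rewrite /l scale0r add0r. Qed.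

Let l_image : \forall t \near (0 : R), 0 <= t -> (cmap c @` cdom c) (l t).
Proof.
have cy : cdom c y := chart_center X y.
have [ O oO imE] := @cmap_image _ _ _ c.
have : (cmap c @` cdom c) (cmap c y) by exists y.
rewrite imE => -[yO y0].
have : \forall t \near (0 : R), O (l t).
  by apply: l_cvg; rewrite l0; exact: open_nbhs_nbhs.
apply: filterS => t Ot t0; split => // k.
by rewrite !mxE addr_ge0 //; case: (_ && _); rewrite ?mulr1 ?mulr0.
Qed.

Let g_near : forall B, nbhs y B -> \forall t \near (0 : R), 0 <= t -> B (g t).
Proof.
move=> B nB; have cy : cdom c y := chart_center X y.
have : nbhs (l 0) [set w | (cmap c @` cdom c) w -> B (cinv c w)].
  by rewrite l0; exact: cinv_near.
move=> /l_cvg; apply: filterS2 l_image => t im H t0; exact/H/im.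
Qed.

Let cmap_g : \forall t \near (0 : R), 0 <= t -> forall k : 'I_n,
  cmap c (g t) ord0 k = cmap c y ord0 k + t * (k == i)%:R.
Proof.
apply: filterS l_image => t im t0 k.
by rewrite /g cinvK; [rewrite !mxE addrC eqxx|exact: im].
Qed.

Let g_face : \forall t \near (0 : R), 0 < t -> face_interior J (g t).
Proof.
suff : \forall t \near (0 : R), forall k, 0 < t -> (hyp k (g t) <-> k \in J).
  by apply: filterS => t H t0 k; exact: H.
apply: (@filter_forall _ _ (fun k t => 0 < t -> (hyp k (g t) <-> k \in J))
  _ (nbhs_filter _)) => k.
have yi : cmap c y ord0 i = 0 by have [_ [H _]] := nbhs_singleton Hi; exact: H.
have [->|kj] := eqVneq k j.
  have H1 := g_near Hi; have H2 := cmap_g.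
  near=> t => t0; have t0' := ltW t0.
  have [_ E] : cdom c (g t) /\ (hyp j (g t) <-> cmap c (g t) ord0 i = 0).
    by move: t0'; near: t.
  have E' : cmap c (g t) ord0 i = t.
    rewrite -[RHS]mulr1 -[RHS]add0r -[in RHS]yi; have := t0'; near: t.
    by apply: filterS H2 => t H /H ->; rewrite eqxx.
  split; last by move=> jJ'; have := jJ; rewrite jJ'.
  by move=> /E; rewrite E' => tE; rewrite tE ltxx in t0.
have [kJ|kJ] := boolP (k \in J); last first.
  have nk : ~ hyp k y by move=> /hy; rewrite !inE (negbTE kj) (negbTE kJ).
  have H := g_near (not_hyp_near nk).
  by apply: filterS H => t H t0; split => // /(H (ltW t0)).
have hk : hyp k y by apply/hy; rewrite !inE kJ orbT.
have [ik Hk] := hyp_embedded hk.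
have yk : cmap c y ord0 ik = 0 by have [_ [H _]] := nbhs_singleton Hk; exact: H.
have [ikE|iki] := eqVneq ik i; last first.
  apply: filterS2 (g_near Hk) cmap_g => t H1 H2 t0; have t0' := ltW t0.
  split => // _; have [_ E] := H1 t0'.
  by apply/E; rewrite (H2 t0') (negbTE iki) mulr0 addr0.
(* Two hypersurfaces with the same defining coordinate at y would coincide
   near y, which contradicts that pi_j multiplies rho_k by a positive factor. *)
exfalso.
have [_ _ hp _ he] := hcol j; have [e [_ He]] := he k kj.
have nU : nbhs y (U j).
  by apply: open_nbhs_nbhs; split; [exact: collar_open|exact: hyp_collar].
have H1 := g_near Hi; have H2 := g_near Hk; have H3 := g_near nU.
have H4 := g_near (collar_retract_near hjy Hi).
have H5 := g_near (collar_retract_near hjy Hk).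
suff : \forall t \near (0 : R)^'+, False by move=> /filter_ex[].
have pos : \forall t \near (0 : R)^'+, 0 < t by exact: nbhs_right_gt.
have W1 P : (\forall t \near (0 : R), P t) -> \forall t \near (0 : R)^'+, P t.
  by move=> HP; apply: cvg_within.
near=> t.
have t0 : 0 < t by near: t.
have t0' := ltW t0.
have [_ E1] : cdom c (g t) /\ (hyp j (g t) <-> cmap c (g t) ord0 i = 0).
  by move: t0'; near: t; exact: W1.
have [_ E2] : cdom c (g t) /\ (hyp k (g t) <-> cmap c (g t) ord0 ik = 0).
  by move: t0'; near: t; exact: W1.
have Ut : U j (g t) by move: t0'; near: t; exact: W1.
have [_ E4] : cdom c (pi j (g t)) /\
    (hyp j (pi j (g t)) <-> cmap c (pi j (g t)) ord0 i = 0).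
  by move: t0'; near: t; exact: W1.
have [_ E5] : cdom c (pi j (g t)) /\
    (hyp k (pi j (g t)) <-> cmap c (pi j (g t)) ord0 ik = 0).
  by move: t0'; near: t; exact: W1.
have E6 : cmap c (g t) ord0 i = t.
  rewrite -[RHS]mulr1 -[RHS]add0r -[in RHS]yi; have := t0'; near: t; apply: W1.
  by apply: filterS cmap_g => t H /H ->; rewrite eqxx.
have : hyp k (pi j (g t)) by apply/E5; rewrite ikE; apply/E4; exact: hp.
move=> /bdf_eq0; have [e0 ->] := He _ Ut.
move=> /eqP; rewrite mulf_eq0 (gt_eqF e0) /= => /eqP /bdf_eq0 /E2.
by rewrite ikE E6 => tE; rewrite tE ltxx in t0.
Unshelve. all: by end_near. Qed.

(** [growth] gives bounds on compact subsets of [U j], so the approach to [y] has to run inside such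
    a set: the image of a closed segment, with its end point on the boundary. *)
Lemma boundary_path : exists (f : R -> T) (d : R),
  [/\ 0 < d, compact (f @` `[0, d]), f @` `[0, d] `<=` U j,
      forall t, 0 < t <= d -> face_interior J (f t) &
      forall B, nbhs y B -> \forall t \near (0 : R)^'+, B (f t)].
Proof.
have nU : nbhs y (U j).
  by apply: open_nbhs_nbhs; split; [exact: collar_open|exact: hyp_collar].
have : \forall t \near (0 : R), [/\ 0 <= t -> (cmap c @` cdom c) (l t),
    0 <= t -> U j (g t) & 0 < t -> face_interior J (g t)].
  by apply: filterS3 l_image (g_near nU) g_face => t ? ? ?; split.
move=> /nbhs_ballP[e /= e0 He].
have e2 : 0 < e / 2 by rewrite divr_gt0.
have Hd t : 0 <= t <= e / 2 -> ball (0 : R) e t.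
  move=> /andP[t0 te]; rewrite /ball /= sub0r normrN ger0_norm //.
  by apply: (le_lt_trans te); rewrite ltr_pdivrMr // ltr_pMr // ltr1n.
exists g, (e / 2); split => //.
- have -> : g @` `[0, e / 2]%classic = cinv c @` (l @` `[0, e / 2]%classic).
    by rewrite image_comp.
  apply: continuous_compact.
    apply: continuous_subspaceW (@cinv_continuous _ _ _ c) => w /= [t + <-].
    rewrite in_itv /= => tI; have [im _ _] := He t (Hd t tI).
    by apply: im; case/andP: tI.
  apply: continuous_compact; last exact: segment_compact.
  by apply: continuous_subspaceT => t B /l_cvg.
- move=> _ [t + <-]; rewrite /= in_itv /= => tI; have [_ H _] := He t (Hd t tI).
  by apply: H; case/andP: tI.
- move=> t /andP[t0 te]; have [|_ _] := He t; last by apply.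
  by apply: Hd; rewrite te ltW.
- move=> B /g_near H; have : \forall t \near (0 : R)^'+, 0 <= t -> B (g t).
    exact: cvg_within.
  apply: filterS2 (nbhs_right_gt 0) => t t0; apply; exact: ltW.
Qed.

End Path.

(** Since [y] lies in the relative interior of the next face, the weight [rest_bdf] is bounded below
    along the path. It is absorbed in the constant, and a pure power of [bdf j] remains. *)
Lemma boundary_filter J j y : j \notin J -> face_interior (j |: J)%SET y ->
  exists F : set_system T, [/\ ProperFilter F, (forall B, nbhs y B -> F B),
    F (collar_face U J j) & forall r u, growth U J j r u ->
      exists C, \forall x \near F, `|u x| <= C * bdf j x `^ r].
Proof.
move=> jJ hy; have hjy : hyp j y by apply/hy; rewrite !inE eqxx.
have [i Hi] := hyp_embedded hjy.
have [f [d [d0 cf fU fJ fy]]] := boundary_path jJ hy Hi.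
have dn : \forall t \near (0 : R)^'+, 0 < t <= d.
  near=> t; apply/andP; split; near: t; [exact: nbhs_right_gt|exact: nbhs_right_le].
have fI t : 0 < t <= d -> (f @` `[0, d]%classic) (f t).
  by move=> /andP[t0 td]; exists t => //; rewrite /= in_itv /= td ltW.
exists (f @ (0 : R)^'+); split.
- exact: fmap_proper_filter.
- exact: fy.
- suff : \forall t \near (0 : R)^'+, collar_face U J j (f t) by [].
  by apply: filterS dn => t tI; split; [exact: fJ|exact/fU/fI].
- move=> r u H; have [N0 HN] := growthP H cf fU.
  have [C C0 HC] := HN _ (leqnn N0).
  have q0 := rest_bdf_gt0 j hy.
  have qE : rest_bdf (j |: J)%SET j y = rest_bdf J j y.
    by apply: eq_bigl => k; rewrite !inE orbA orbb.
  rewrite qE in q0; set q := rest_bdf J j in q0.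
  have nq : \forall x \near y, q y / 2 < q x.
    have h : q y / 2 < q y by rewrite ltr_pdivrMr // ltr_pMr // ltr1n.
    by have := smooth_on_cvg (smooth_on_rest_bdf J j) I (lt_nbhsr h);
      apply: filterS => x; apply.
  exists (C * (q y / 2) ^- N0).
  suff : \forall t \near (0 : R)^'+,
    `|u (f t)| <= C * (q y / 2) ^- N0 * bdf j (f t) `^ r by [].
  apply: filterS2 dn (fy _ nq) => t tI qt.
  apply: le_trans (HC _ (fI t tI) (fJ t tI)) _.
  rewrite mulrAC ler_wpM2r ?powR_ge0 // ler_wpM2l //.
  have q2 : 0 < q y / 2 by rewrite divr_gt0.
  rewrite lef_pV2 ?posrE ?exprn_gt0 //; last exact: lt_trans qt.
  by rewrite lerXn2r ?nnegrE // ltW //; exact: lt_trans qt.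
Unshelve. all: by end_near. Qed.

Section Limits.
Variables (J : {set 'I_(nhyp X)}) (j : 'I_(nhyp X)) (y : T) (F : set_system T).
Hypotheses (jJ : j \notin J) (hy : face_interior (j |: J)%SET y).
Hypotheses (FF : ProperFilter F) (Fy : forall B, nbhs y B -> F B).
Hypothesis FW : F (collar_face U J j).

Lemma bdf_boundary_cvg : bdf j x @[x --> F] --> (0 : R)^'+.
Proof.
have hjy : bdf j y = 0 by apply/bdf_eq0/hy; rewrite !inE eqxx.
move=> B [e /= e0 He].
have H1 : F [set x | `|bdf j x| < e].
  apply: Fy; apply: (bdf_cvg (B := [set r | `|r| < e])); rewrite hjy.
  by apply/nbhs_ballP; exists e => //= r; rewrite /ball /= sub0r normrN.
suff : \forall x \near F, B (bdf j x) by [].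
apply: filterS2 FW H1 => x Wx H; apply: He => /=.
  by rewrite sub0r normrN.
by case: Wx => Jx _; exact: face_bdf_gt0 Jx jJ.
Qed.

Lemma coef_boundary_cvg c : smooth_on X (face_interior (j |: J)%SET) c ->
  c (pi j x) @[x --> F] --> c y.
Proof.
move=> Hc B nB; have hjy : hyp j y by apply/hy; rewrite !inE eqxx.
have /(collar_retract_near hjy) /Fy H := smooth_on_cvg Hc hy nB.
suff : \forall x \near F, B (c (pi j x)) by [].
by apply: filterS2 FW H => x /(collar_retract_face jJ) h; exact.
Qed.

End Limits.

(** Along the boundary filter u - c o pi_j tends to 0 and c o pi_j tends to [c y], so [c y] is a
    limit of values of [u] in the closed set [K]. *)
Lemma boundary_value_mem J j y r u c (K : set R) : j \notin J ->
  face_interior (j |: J)%SET y -> compact K ->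
  smooth_on X (face_interior (j |: J)%SET) c ->
  (forall x, face_interior J x -> K (u x)) ->
  0 < r -> growth U J j r (fun x => u x - c (pi j x)) -> K (c y).
Proof.
move=> jJ hy cK Hc uK r0 Gr.
have [F [FF Fy FW HF]] := boundary_filter jJ hy.
have [C HC] := HF _ _ Gr.
have cl : closed K by apply: compact_closed => //; exact: norm_hausdorff.
have c1 : c (pi j x) @[x --> F] --> c y by exact: (coef_boundary_cvg jJ hy FF Fy FW Hc).
have c2 : C * bdf j x `^ r @[x --> F] --> 0.
  rewrite -[X in _ --> X](mulr0 C); apply: cvgMr.
  exact: (cvg_comp _ _ (bdf_boundary_cvg jJ hy FF Fy FW) (powR_cvg0 r0)).
have c3 : u x - c (pi j x) @[x --> F] --> 0.
  apply/cvgr0Pnorm_lt => e e0.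
  have : \forall x \near F, `|C * bdf j x `^ r| < e by move/cvgr0Pnorm_lt: c2; exact.
  by apply: filterS2 HC => x h1 /(le_lt_trans (ler_norm _)); exact: le_lt_trans.
have c4 : u x @[x --> F] --> c y.
  have := cvgD c3 c1; rewrite add0r.
  have -> : (fun x => u x - c (pi j x)) + (fun x => c (pi j x)) = u.
  by apply/funext => x; rewrite !fctE subrK.
  exact.
apply: (closed_cvg _ cl _ _ c4).
by apply: filterS FW => x [Jx _]; exact: uK.
Qed.

End BoundaryFilter.

(** * Truncated expansions *)

Section Span.
Variables (R : realType) (n : nat) (T : topologicalType).
Variable X : mfd_corners R n T.
Variables (U : 'I_(nhyp X) -> set T) (pi : 'I_(nhyp X) -> T -> T).
Hypothesis oU : forall j, open (U j).
Variable E : 'I_(nhyp X) -> set (R * nat).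
Hypothesis E0 : forall j, E j (0, 0%N).
Hypothesis ED : forall j s p s' p', E j (s, p) -> E j (s', p') ->
  E j (s + s', (p + p')%N).
Implicit Types (P : (T -> R) -> Prop) (Q : T -> {poly R}) (u v w : T -> R).

Variables (J : {set 'I_(nhyp X)}) (j : 'I_(nhyp X)).
Hypothesis jJ : j \notin J.
Let W := collar_face U J j.

(** The coefficient of degree p of [Q y] is that of rho^s log^p rho. Multiplying expansions then
    amounts to adding exponents and multiplying polynomials. *)
Definition log_term s Q : T -> R :=
  fun x => bdf j x `^ s * (Q (pi j x)).[ln (bdf j x)].

(* Only the sum of the terms with a given exponent is required to satisfy the
   conormal bounds: this is what differences of the given expansions provide. *)
Definition block P s Q := [/\ 0 <= s, forall p, P (fun y => (Q y)`_p),
  forall y p, ~ E j (s, p) -> (Q y)`_p = 0 &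
  forall m, near_symbol U J j m s (log_term s Q)].

(** An exponent may occur in several blocks, which makes closure under sums immediate;
    [span_collect] merges them when uniqueness is needed. [P] stands for the class of coefficients
    on the next face. *)
Inductive log_span P : (T -> R) -> Prop :=
| log_span0 : log_span P (fun=> 0)
| log_spanD s Q v : block P s Q -> log_span P v ->
    log_span P (fun x => log_term s Q x + v x).

Lemma span_near_symbol P v m : log_span P v -> near_symbol U J j m 0 v.
Proof.
elim=> [|s Q w [s0 _ _ H] _ IH]; first exact/symbol_near/symbol0.
by apply: near_symbolD => //; exact: le_near_symbol (H m).
Qed.

Lemma span_add P u v : log_span P u -> log_span P v -> log_span P (fun x => u x + v x).
Proof.
move=> Hu Hv; elim: Hu => [|s Q w HQ _ IH].
  by under eq_fun do rewrite add0r.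
by under eq_fun do rewrite -addrA; exact: log_spanD.
Qed.

Lemma span_block P s Q : block P s Q -> log_span P (log_term s Q).
Proof.
move=> H; rewrite (_ : log_term s Q = fun x => log_term s Q x + 0).
  by apply: log_spanD => //; exact: log_span0.
by apply/funext => x; rewrite addr0.
Qed.

Section Algebra.
Variable P : (T -> R) -> Prop.
Hypothesis Pcst : forall c, P (fun=> c).
Hypothesis PD : forall u v, P u -> P v -> P (fun x => u x + v x).
Hypothesis PM : forall u v, P u -> P v -> P (fun x => u x * v x).

Lemma closed_sum (I : Type) (r : seq I) (F : I -> T -> R) :
  (forall i, P (F i)) -> P (fun x => \sum_(i <- r) F i x).
Proof.
move=> H; elim: r => [|i r IH].
  by under eq_fun do rewrite big_nil; exact: Pcst.
by under eq_fun do rewrite big_cons; exact: PD.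
Qed.

Lemma log_term0 c : log_term 0 (fun y => (c y)%:P) = c \o pi j.
Proof. by apply/funext => x; rewrite /log_term powRr0 mul1r hornerC. Qed.

Lemma block0 c : P c -> (forall m, near_symbol U J j m 0 (c \o pi j)) ->
  block P 0 (fun y => (c y)%:P).
Proof.
move=> Pc Hc; split=> // [p|y p Ep|m].
- under eq_fun do rewrite coefC; case: (p == 0%N) => //; exact: Pcst.
- by rewrite coefC; have [p0|//] := eqVneq p 0%N; rewrite p0 in Ep; have := Ep (E0 j).
- by rewrite log_term0.
Qed.

Lemma span_cst c : log_span P (fun=> c).
Proof.
rewrite (_ : (fun=> c) = log_term 0 (fun=> c%:P)).
  by apply/span_block/(@block0 (fun=> c)) => // m; exact: near_symbol_cst.
exact/esym/(log_term0 (fun=> c)).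
Qed.

Lemma log_termM s s' Q Q' x : W x ->
  log_term s Q x * log_term s' Q' x = log_term (s + s') (fun y => Q y * Q' y) x.
Proof.
move=> [Jx _]; rewrite /log_term hornerM powRD; first exact: mulrACA.
by rewrite implybE (gt_eqF (face_bdf_gt0 Jx jJ)) orbT.
Qed.

Lemma blockM s s' Q Q' : block P s Q -> block P s' Q' ->
  block P (s + s') (fun y => Q y * Q' y).
Proof.
move=> [s0 PQ EQ HQ] [s0' PQ' EQ' HQ']; split.
- exact: addr_ge0.
- move=> p; under eq_fun do rewrite coefM; apply: closed_sum => i; exact: PM.
- move=> y p Ep; rewrite coefM big1 // => i _.
  have [Ei|Ei] := pselect (E j (s, i : nat)); last by rewrite EQ ?mul0r.
  rewrite EQ' ?mulr0 // => Ei'; apply: Ep.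
  by have := ED Ei Ei'; rewrite subnKC // -ltnS.
- move=> m; apply: (eq_near_symbol oU) (near_symbolM oU jJ (HQ m) (HQ' m)).
  by move=> x Wx; exact: log_termM.
Qed.

(** Agreement is asked on [W], where [bdf j] is positive and its real powers multiply by adding
    exponents. *)
Definition spans u := exists2 v, log_span P v & forall x, W x -> u x = v x.

Lemma spans_cst c : spans (fun=> c).
Proof. by exists (fun=> c) => //; exact: span_cst. Qed.

Lemma spansD u v : spans u -> spans v -> spans (fun x => u x + v x).
Proof.
move=> [u' Hu Eu] [v' Hv Ev]; exists (fun x => u' x + v' x); first exact: span_add.
by move=> x Wx; rewrite Eu // Ev.
Qed.

Lemma spansM u v : spans u -> spans v -> spans (fun x => u x * v x).
Proof.
move=> [u' Hu Eu] [v' Hv Ev].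
suff [w Hw Ew] : spans (fun x => u' x * v' x).
  by exists w => // x Wx; rewrite Eu // Ev // Ew.
elim: Hu => [|s Q w HQ _ IH].
  by under eq_fun do rewrite mul0r; exact: spans_cst.
under eq_fun do rewrite mulrDl; apply: spansD => // {IH w}.
elim: Hv => [|s' Q' w HQ' _ IH].
  by under eq_fun do rewrite mulr0; exact: spans_cst.
under eq_fun do rewrite mulrDr; apply: spansD => //.
exists (log_term (s + s') (fun y => Q y * Q' y)); first exact/span_block/blockM.
by move=> x Wx; exact: log_termM.
Qed.

Lemma spansX u k : spans u -> spans (fun x => u x ^+ k).
Proof.
move=> H; elim: k => [|k IH]; first by under eq_fun do rewrite expr0; exact: spans_cst.
by under eq_fun do rewrite exprS; exact: spansM.
Qed.

Lemma spans_sum (I : Type) (r : seq I) (F : I -> T -> R) :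
  (forall i, spans (F i)) -> spans (fun x => \sum_(i <- r) F i x).
Proof.
move=> H; elim: r => [|i r IH].
  by under eq_fun do rewrite big_nil; exact: spans_cst.
by under eq_fun do rewrite big_cons; exact: spansD.
Qed.

(** Below [s0] the pair (0, 0) is the only possible element of [E j]. A block of smaller exponent is
    therefore zero or the pullback of a single coefficient, and the latter add up to [c], the
    function around which f will be expanded. *)
Lemma span_split s0 v : (forall s p, E j (s, p) -> s0 <= s \/ (s = 0 /\ p = 0%N)) ->
  log_span P v -> exists c v', [/\ P c, forall m, near_symbol U J j m 0 (c \o pi j),
    spans v', forall m, near_symbol U J j m s0 v' &
    forall x, W x -> v x = c (pi j x) + v' x].
Proof.
move=> Hs0; elim=> [|s Q w HQ _ [c [v' [Pc Hc Hv Sv E']]]].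
  exists (fun=> 0), (fun=> 0); split=> //.
  - by move=> m; exact: near_symbol_cst.
  - exact: spans_cst.
  - by move=> m; exact/symbol_near/symbol0.
  - by move=> x _; rewrite addr0.
have [s0s|ss0] := leP s0 s.
  exists c, (fun x => log_term s Q x + v' x); split => //.
  - by apply: spansD => //; exists (log_term s Q) => //; exact: span_block.
  - move=> m; apply: near_symbolD => //.
    by apply: le_near_symbol s0s _ => //; case: HQ.
  - by move=> x Wx; rewrite E' // addrCA.
have [sge PQ EQ SQ] := HQ.
have Q0 : Q = fun y => ((Q y)`_0)%:P.
  apply/funext => y; apply/polyP => p; rewrite coefC.
  have [->//|p0] := eqVneq p 0%N; apply: EQ => /Hs0[|[_]]; first by rewrite leNgt ss0.
  by move/eqP; rewrite (negbTE p0).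
have [s0'|sn0] := eqVneq s 0.
  have EL : log_term s Q = (fun y => (Q y)`_0) \o pi j.
    by rewrite s0' Q0 log_term0; apply/funext => x /=; rewrite coefC eqxx.
  exists (fun y => (Q y)`_0 + c y), v'; split => //.
  - exact: PD.
  - move=> m; apply: (@near_symbolD _ _ _ _ _ _ _ _ _ _
      ((fun y => (Q y)`_0) \o pi j) (c \o pi j)) => //.
    by rewrite -EL -s0'.
  - by move=> x Wx; rewrite EL E' // addrA.
have Qz y : Q y = 0.
  apply/polyP => p; rewrite coef0; apply: EQ => /Hs0[|[s00 _]].
    by rewrite leNgt ss0.
  by rewrite s00 eqxx in sn0.
exists c, v'; split => // x Wx.
by rewrite /log_term Qz horner0 mulr0 add0r E'.
Qed.

End Algebra.
End Span.

(** * Products of truncated expansions and composition with a smooth function *)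

Section PC.
Variables (R : realType) (n : nat) (T : topologicalType).
Variable X : mfd_corners R n T.
Variables (U : 'I_(nhyp X) -> set T) (pi : 'I_(nhyp X) -> T -> T).
Hypothesis hcol : forall j, collar j (U j) (pi j).
Variable E : 'I_(nhyp X) -> set (R * nat).
Hypothesis E0 : forall j, E j (0, 0%N).
Hypothesis ED : forall j s p s' p', E j (s, p) -> E j (s', p') ->
  E j (s + s', (p + p')%N).
Hypothesis Egap : forall j, exists s0 : R, [/\ 0 < s0, s0 <= 1 &
  forall s p, E j (s, p) -> s0 <= s \/ (s = 0 /\ p = 0%N)].
Implicit Types (u v w : T -> R) (J : {set 'I_(nhyp X)}).

Let oU j : open (U j) := collar_open hcol j.

(* Polyhomogeneity to depth d, with coefficients that may depend on the order
   of truncation. *)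
Fixpoint pc d J u : Prop :=
  smooth_on X (face_interior J) u /\
  if d is d'.+1 then
    forall j, j \notin J -> forall r, exists v,
      log_span U pi E J j (pc d' (j |: J)%SET) v /\
      forall m, symbol U J j m r (fun x => u x - v x)
  else True.

Lemma pc_smooth d J u : pc d J u -> smooth_on X (face_interior J) u.
Proof. by case: d => [|d] []. Qed.

Lemma pc_cst d J c : pc d J (fun=> c).
Proof.
elim: d J c => [|d IH] J c; first by split => //; exact: smooth_on_cst.
split; first exact: smooth_on_cst.
move=> j jJ r; exists (fun=> c); split; first by apply: span_cst => //; exact: IH.
by move=> m; apply: (eq_symbol oU) (symbol0 oU J j m r) => x _; rewrite subrr.
Qed.

Lemma pcD d J u v : pc d J u -> pc d J v -> pc d J (fun x => u x + v x).
Proof.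
case: d => [|d] [Su Hu] [Sv Hv]; split => //; try exact: smooth_onD.
move=> j jJ r; have [u' [su Eu]] := Hu j jJ r; have [v' [sv Ev]] := Hv j jJ r.
exists (fun x => u' x + v' x); split; first exact: span_add.
move=> m; apply: (eq_symbol oU) (symbolD oU (Eu m) (Ev m)) => x _; ring.
Qed.

Lemma pc_spans d J j r u : (exists2 v, spans U pi E J j (pc d (j |: J)%SET) v &
    forall m, symbol U J j m r (fun x => u x - v x)) ->
  exists v, log_span U pi E J j (pc d (j |: J)%SET) v /\
    forall m, symbol U J j m r (fun x => u x - v x).
Proof.
move=> [v [w sw Ew] Hv]; exists w; split => // m.
by apply: (eq_symbol oU) (Hv m) => x Wx; rewrite Ew.
Qed.

Lemma spans_span J j P v : log_span U pi E J j P v -> spans U pi E J j P v.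
Proof. by move=> H; exists v. Qed.

Lemma pcM d J u v : pc d J u -> pc d J v -> pc d J (fun x => u x * v x).
Proof.
elim: d J u v => [|d IH] J u v [Su Hu] [Sv Hv]; split => //; try exact: smooth_onM.
(* [q > r] leaves room for the loss in [near_symbol], and [q > 0] ensures that [v], like its
   truncation, has order 0. The error of the product is (u - u') v + u' (v - v'). *)
move=> j jJ r; set q := `|r| + 1.
have q0 : 0 < q by rewrite ltr_wpDl.
have rq : r < q by rewrite (le_lt_trans (ler_norm r)) // ltrDl.
have [u' [su Eu]] := Hu j jJ q; have [v' [sv Ev]] := Hv j jJ q.
apply: pc_spans; exists (fun x => u' x * v' x).
  apply: spansM => //; try exact: spans_span.
  - exact: pc_cst.
  - exact: pcD.
  - exact: IH.
have Nu m : near_symbol U J j m 0 u' by exact: span_near_symbol su.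
have Nv m : near_symbol U J j m 0 v.
  have H := near_symbolD oU (span_near_symbol oU jJ m sv)
    (le_near_symbol (ltW q0) (symbol_near jJ (Ev m))).
  by apply: (eq_near_symbol oU) H => x _; rewrite addrC subrK.
move=> m; apply: (near_symbol_lt rq).
have H1 := near_symbolM oU jJ (symbol_near jJ (Eu m)) (Nv m).
have H2 := near_symbolM oU jJ (Nu m) (symbol_near jJ (Ev m)).
rewrite addr0 in H1; rewrite add0r in H2.
by apply: (eq_near_symbol oU) (near_symbolD oU H1 H2) => x _; ring.
Qed.

Lemma pc_comp d J u (O K : set R) (f : R -> R) :
  open O -> compact K -> K `<=` O -> smooth_line O f ->
  (forall x, face_interior J x -> K (u x)) -> pc d J u -> pc d J (f \o u).
Proof.
move=> oO cK KO; elim: d J u f => [|d IH] J u f Hf uK [Su Hu].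
  by split => //; apply: (smooth_on_comp_line oO Hf) => // x /uK /KO.
split; first by apply: (smooth_on_comp_line oO Hf) => // x /uK /KO.
move=> j jJ r; have [s0 [s0_gt0 s0_le1 Hs0]] := Egap j.
(* As for products [q > r]; moreover [q >= 1 >= s0], so the truncation error of [u] does not spoil
   the order [s0] of [u - a]. *)
set q := `|r| + 1.
have q1 : 1 <= q by rewrite lerDr.
have q0 : 0 < q by exact: lt_le_trans q1.
have rq : r < q by rewrite (le_lt_trans (ler_norm r)) // ltrDl.
have [v [sv Ev]] := Hu j jJ q.
set P := pc d (j |: J)%SET in sv *.
have Pcst c : P (fun=> c) by exact: pc_cst.
have PD u1 u2 : P u1 -> P u2 -> P (fun x => u1 x + u2 x) by exact: pcD.
have PM u1 u2 : P u1 -> P u2 -> P (fun x => u1 x * u2 x) by exact: pcM.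
have [c [v' [Pc Hc Hv' Sv' Evv]]] := span_split oU E0 jJ Pcst PD Hs0 sv.
set a := c \o pi j in Hc.
have s0q : s0 <= q by exact: le_trans q1.
have ua m : near_symbol U J j m s0 (fun x => u x - a x).
  have H := near_symbolD oU (Sv' m)
    (le_near_symbol s0q (symbol_near jJ (Ev m))).
  by apply: (eq_near_symbol oU) H => x Wx; rewrite Evv //= /a /=; ring.
have cKy y : face_interior (j |: J)%SET y -> K (c y).
  move=> hy; apply: (boundary_value_mem hcol jJ hy cK (pc_smooth Pc) uK (r := s0 / 2)).
    by rewrite divr_gt0.
  have s2 : s0 / 2 < s0 by rewrite ltr_pdivrMr // ltr_pMr // ltr1n.
  exact: symbol_growth (near_symbol_lt s2 (ua 0%N)).
have aK x : collar_face U J j x -> K (a x).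
  by move=> Wx; apply/cKy/(collar_retract_face hcol jJ Wx).
have uK' x : collar_face U J j x -> K (u x) by move=> [/uK].
have u0 m : near_symbol U J j m 0 u.
  have H := near_symbolD oU (Hc m) (le_near_symbol (ltW s0_gt0) (ua m)).
  by apply: (eq_near_symbol oU) H => x _; ring.
(* Each factor [u - a] gains [s0], so [M] Taylor terms leave a remainder of order beyond [r]. *)
have [M HM] : exists M : nat, r < M%:R * s0.
  exists (Num.Def.archi_bound `|r / s0|).
  rewrite -ltr_pdivrMr // (le_lt_trans (ler_norm _)) //.
  exact: archi_boundP.
pose g (k : nat) := fun x => k`!%:R^-1 * derive1n k f x.
have Hg k : smooth_line O (g k) by apply: smooth_lineZ => //; exact: smooth_line_n.
have ga k : spans U pi E J j P (g k \o a).
  exists (g k \o a) => //.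
  rewrite -[g k \o a]/((g k \o c) \o pi j) -log_term0.
  apply: span_block => //; apply: block0 => //.
    exact: IH (Hg k) cKy Pc.
  by move=> m; exact: (near_symbol_comp_line oU jJ oO cK KO (Hg k) aK).
have ga0 k m : near_symbol U J j m 0 (g k \o a).
  exact: (near_symbol_comp_line oU jJ oO cK KO (Hg k) aK).
have Nv' m : near_symbol U J j m 0 v' by exact: le_near_symbol (ltW s0_gt0) (Sv' m).
(* Powers of [u - a] are exchanged for powers of [v'], which lie in the span. With x = u - a and y =
   v', the difference x - y is the truncation error [u - v], and x^(k+1) - y^(k+1) = x (x^k - y^k) +
   y^k (x - y). *)
have pw k m : near_symbol U J j m q (fun x => (u x - a x) ^+ k - v' x ^+ k).
  elim: k => [|k IHk].
    under eq_fun do rewrite !expr0 subrr; exact/symbol_near/symbol0.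
  have Na : near_symbol U J j m 0 (fun x => u x - a x).
    exact: le_near_symbol (ltW s0_gt0) (ua m).
  have Nk : near_symbol U J j m 0 (fun x => v' x ^+ k).
    by have := near_symbolX oU jJ k (Nv' m); rewrite mulr0.
  have H1 := near_symbolM oU jJ Na IHk.
  have Nv2 := symbol_near jJ (Ev m).
  have H2 := near_symbolM oU jJ Nk Nv2.
  rewrite add0r in H1; rewrite add0r in H2.
  apply: (eq_near_symbol oU) (near_symbolD oU H1 H2) => x Wx.
  by rewrite Evv // !exprS /a /=; ring.
apply: pc_spans.
exists (fun x => \sum_(k < M) (g k \o a) x * v' x ^+ k).
  apply: spans_sum => // k; apply: spansM => //; exact: spansX.
move=> m.
have T1 : near_symbol U J j m (M%:R * s0) (fun x => taylor_rem M f (a x) (u x)).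
  exact: (near_symbol_taylor_rem oU jJ oO cK KO aK uK' Hc u0 ua).
have T2 : near_symbol U J j m q (fun x => \sum_(k < M)
    (g k \o a) x * ((u x - a x) ^+ k - v' x ^+ k)).
  elim: (index_enum _) => [|k s IHs].
    under eq_fun do rewrite big_nil; exact/symbol_near/symbol0.
  under eq_fun do rewrite big_cons; apply: near_symbolD => //.
  by rewrite -[q]add0r; apply: near_symbolM.
apply: (eq_symbol oU) (symbolD oU (near_symbol_lt HM T1)
   (near_symbol_lt rq T2)) => x _.
rewrite /taylor_rem -addrA; congr (_ + _).
rewrite addrC -!sumrN -!big_split /=; apply: eq_bigr => k _.
by rewrite /g /=; ring.
Qed.

End PC.

(** * Asymptotic uniqueness *)

Section RealAsymptotics.
Variable R : realType.
Implicit Types (x y : R) (z w : R * nat).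

Lemma powR_smooth_line (s : R) : smooth_line [set x : R | 0 < x] (fun x => x `^ s).
Proof.
have H k : exists c t : R, forall x, 0 < x ->
    derive1n k (fun x : R => x `^ s) x = c * x `^ t.
  elim: k => [|k [c [t IH]]]; first by exists 1, s => x x0; rewrite derive1n0 mul1r.
  exists (c * t), (t - 1) => x x0; rewrite derive1nS derive1E.
  rewrite (@near_eq_derive _ _ _ _ (c *: (fun y : R => y `^ t))).
    rewrite deriveZ; last first.
      by apply: derivable_powR; rewrite in_itv /= x0.
    rewrite -derive1E powR_derive1 ?in_itv /= ?x0 //.
    by rewrite /GRing.scale /= mulrA.
  near=> y; apply: IH; near: y; exact: lt_nbhsr.
move=> k x x0; have [c [t Hct]] := H k.
apply: (@near_eq_derivable _ _ _ (c *: (fun y : R => y `^ t))).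
  near=> y; rewrite Hct //; near: y; exact: lt_nbhsr.
by apply: derivableZ; apply: derivable_powR; rewrite in_itv /= x0.
Unshelve. all: by end_near. Qed.

Lemma eq_derive1n (P : set R) (f g : R -> R) k x : open P ->
  (forall y, P y -> f y = g y) -> P x -> derive1n k f x = derive1n k g x.
Proof.
move=> oP fg; elim: k x => [|k IH] x Px; first by rewrite !derive1n0 fg.
rewrite !derive1nS !derive1E; apply: near_eq_derive.
by near=> y; apply: IH; near: y; exact: open_nbhs_nbhs.
Unshelve. all: by end_near. Qed.

Lemma ln_smooth_line : smooth_line [set x : R | 0 < x] (@ln R).
Proof.
have D x : 0 < x -> derive1 (@ln R) x = x `^ (-1).
  move=> x0; rewrite derive1E powR_inv1 ?ltW //.
  by have [_ ->] := is_derive1_ln x0.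
have E k x : 0 < x ->
    derive1n k (derive1 (@ln R)) x = derive1n k (fun y : R => y `^ (-1)) x.
  by move=> x0; apply: (@eq_derive1n [set y | 0 < y]) => //; exact: open_gt.
move=> [|k] x x0.
  by have [] := is_derive1_ln x0.
rewrite derive1Sn.
apply: (@near_eq_derivable _ _ _ (derive1n k (fun y : R => y `^ (-1)))).
  by near=> y; rewrite E //; near: y; exact: lt_nbhsr.
exact: powR_smooth_line.
Unshelve. all: by end_near. Qed.

Definition monomial z x := x `^ z.1 * ln x ^+ z.2.

(* z dominates w as x -> 0+ *)
Definition dominates z w := (z.1 < w.1) || ((z.1 == w.1) && (w.2 < z.2)%N).

(** This is ln t < t at t = x^(- a), since - ln x = a^-1 ln t. *)
Lemma ln_powR_bound (a x : R) p : 0 < a -> 0 < x < 1 ->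
  `|ln x| ^+ p <= (a^-1) ^+ p * x `^ (- (a * p%:R)).
Proof.
move=> a0 /andP[x0 x1].
have l1 : `|ln x| <= a^-1 * x `^ (- a).
  rewrite ltr0_norm ?ln_lt0 ?x0 // ler_pdivlMl // mulrN -mulNr -ln_powR.
  by apply/ltW/ln_sublinear; exact: powR_gt0.
apply: le_trans (_ : (a^-1 * x `^ (- a)) ^+ p <= _).
  by rewrite lerXn2r ?nnegrE // mulr_ge0 ?powR_ge0 // invr_ge0 ltW.
rewrite exprMn ler_wpM2l //; first by rewrite exprn_ge0 // invr_ge0 ltW.
by rewrite -powR_mulrn ?powR_ge0 // -powRrM mulNr.
Qed.

Lemma monomial_ratio_cvg z w : dominates z w ->
  monomial w x / monomial z x @[x --> 0^'+] --> (0 : R).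
Proof.
have n1 : \forall x \near (0 : R)^'+, 0 < x < 1.
  near=> x; apply/andP; split; near: x; [exact: nbhs_right_gt|exact: nbhs_right_lt].
have nln : \forall x \near (0 : R)^'+, ln x < -1.
  by move/cvgrNyPlt: (@lnNy R); apply.
case: z w => [s p] [s' p']; rewrite /dominates /monomial /=.
move=> /orP[ss'|/andP[/eqP <- pp]].
  (* The gap [s' - s] is cut into [p'.+1] equal parts: [p'] of them pay for the logarithms, and the
     last one leaves a positive power of [x]. *)
  pose a := (s' - s) / (p'.+1)%:R.
  have a0 : 0 < a by rewrite divr_gt0 ?subr_gt0.
  have key : (a^-1) ^+ p' * x `^ a @[x --> 0^'+] --> (0 : R).
    rewrite -[X in _ --> X](mulr0 ((a^-1) ^+ p')); apply: cvgMr; exact: powR_cvg0.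
  apply/cvgr0Pnorm_lt => e e0.
  have : \forall x \near (0 : R)^'+, `|(a^-1) ^+ p' * x `^ a| < e.
    by move/cvgr0Pnorm_lt: key; exact.
  apply: filterS3 n1 nln => x xI lx; apply: le_lt_trans.
  have /andP[x0 x1] := xI.
  have xs : x `^ s != 0 by rewrite gt_eqF // powR_gt0.
  have -> : x `^ s' * ln x ^+ p' / (x `^ s * ln x ^+ p) =
      x `^ (s' - s) * ln x ^+ p' / ln x ^+ p.
    rewrite powRB ?gt_eqF ?implybT // invfM; ring.
  rewrite [in leRHS]ger0_norm; last first.
    by rewrite mulr_ge0 ?powR_ge0 ?exprn_ge0 ?invr_ge0 // ltW.
  rewrite !normrM ger0_norm ?powR_ge0 // normfV !normrX.
  apply: (@le_trans _ _ (x `^ (s' - s) * `|ln x| ^+ p')).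
    rewrite ler_piMr ?mulr_ge0 ?powR_ge0 ?exprn_ge0 // invf_le1.
      by rewrite exprn_ege1 // ltr0_norm; lra.
    by rewrite exprn_gt0 // normr_gt0; lra.
  apply: le_trans (_ : x `^ (s' - s) * ((a^-1) ^+ p' * x `^ (- (a * p'%:R))) <= _).
    by rewrite ler_wpM2l ?powR_ge0 //; exact: ln_powR_bound.
  rewrite mulrCA -powRD; last by rewrite (gt_eqF x0) implybT.
  have -> // : s' - s + - (a * p'%:R) = a.
  have p0 : p'.+1%:R != 0 :> R by rewrite pnatr_eq0.
  rewrite /a -natr1; field; by rewrite natr1.
apply/cvgr0Pnorm_lt => e e0.
have nle : \forall x \near (0 : R)^'+, ln x < - e^-1.
  by move/cvgrNyPlt: (@lnNy R); apply.
apply: filterS3 n1 nln nle => x /andP[x0 _] lx lxe.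
have xs : x `^ s != 0 by rewrite gt_eqF // powR_gt0.
have l0 : ln x != 0 by rewrite lt_eqF //; lra.
have -> : x `^ s * ln x ^+ p' / (x `^ s * ln x ^+ p) = (ln x ^+ (p - p'))^-1.
  rewrite -mulf_div divff // mul1r -[in LHS](subnK (ltnW pp)) exprD invfM mulrCA.
  by rewrite divff ?mulr1 // expf_neq0.
have e1 : 0 < e^-1 by rewrite invr_gt0.
have ln1 : 1 <= `|ln x| by rewrite ltr0_norm; lra.
have lne : e^-1 < `|ln x| by rewrite ltr0_norm; lra.
rewrite normfV normrX invf_plt ?posrE ?exprn_gt0 //; last exact: lt_le_trans ln1.
apply: (lt_le_trans lne); rewrite -[leLHS]expr1; apply: ler_weXn2l => //.
by rewrite subn_gt0.
Unshelve. all: by end_near. Qed.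

(** The order of size near 0, largest monomial first, in the reflexive and total form that [sort]
    expects. *)
Definition lex_le z w := (z.1 < w.1) || ((z.1 == w.1) && (w.2 <= z.2)%N).

Lemma lex_le_total : total lex_le.
Proof.
move=> [s p] [t q]; rewrite /lex_le /=; case: (ltgtP s t) => //= _.
exact: leq_total.
Qed.

Lemma lex_le_trans : transitive lex_le.
Proof.
move=> [s p] [t q] [r k]; rewrite /lex_le /=.
move=> /orP[h1|/andP[/eqP h1 h1']] /orP[h2|/andP[/eqP h2 h2']].
- by rewrite (lt_trans h1 h2).
- by rewrite -h2 h1.
- by rewrite h1 h2.
- by rewrite h1 h2 eqxx (leq_trans h2' h1') orbT.
Qed.

Lemma lex_le_dominates z w : lex_le z w -> z != w -> dominates z w.
Proof.
case: z w => [s p] [t q]; rewrite /lex_le /dominates /= => /orP[->//|/andP[/eqP -> qp]].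
move=> H; rewrite eqxx ltn_neqAle qp andbT /=; apply/orP; right.
by apply: contra H => /eqP ->.
Qed.

End RealAsymptotics.

(** The sum over pairs is regrouped by exponent. It is cut down to its support and then widened to
    the rectangle of exponents in [L] and degrees below [N], where the added pairs have coefficient
    0. *)
Lemma fsbig_poly (R : realType) (A : set (R * nat)) (a : R -> nat -> R)
    (Q : R -> {poly R}) (L : seq R) (r t l : R) :
  (forall s p, s <= r -> (Q s)`_p = if `[< A (s, p) >] then a s p else 0) ->
  uniq L -> (forall s, s \in L -> s <= r) ->
  (forall s, s <= r -> s \notin L -> Q s = 0) ->
  \sum_(z \in [set z : R * nat | A z /\ z.1 <= r])
    a z.1 z.2 * t `^ z.1 * l ^+ z.2 = \sum_(s <- L) t `^ s * (Q s).[l].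
Proof.
move=> HQ uL Lr L0.
pose F (z : R * nat) := (Q z.1)`_z.2 * t `^ z.1 * l ^+ z.2.
transitivity (\sum_(z \in [set z : R * nat | A z /\ z.1 <= r]) F z).
  apply: eq_fsbigr => -[s p]; rewrite inE /= => -[Asp sr].
  by rewrite /F /= HQ // asboolT.
pose N := \max_(s <- L) size (Q s).
have QN s : s \in L -> (size (Q s) <= N)%N by move=> sL; exact: leq_bigmax_seq.
rewrite fsbig_supp.
rewrite (@fsbig_fwiden _ _ _ _ [seq (s, p) | s <- L, p <- iota 0 N]) /=; first last.
- move=> [s p] /= [/allpairsP[[s' p'] /= [sL _ [-> ->]]] H].
  have s'r := Lr _ sL; apply: contrapT => F0; apply: H; split => //; split => //.
  apply: contrapT => nA; apply: F0.
  by rewrite /F /= HQ // asboolF // !mul0r.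
- by rewrite allpairs_uniq // ?iota_uniq // => -[? ?] [? ?] _ _ [-> ->].
- move=> [s p] /= [[Asp sr] F0].
  have sL : s \in L.
    by apply: contra_notT F0 => sL; rewrite /F /= (L0 _ sr sL) coef0 !mul0r.
  apply/allpairsP; exists (s, p); split => //=; rewrite mem_iota /= add0n.
  rewrite (leq_trans _ (QN _ sL)) // ltnNge; apply: contra_notN F0 => sp.
  by rewrite /F /= nth_default // !mul0r.
rewrite big_allpairs big_seq [RHS]big_seq; apply: eq_bigr => s sL.
rewrite (horner_coef_wide _ (QN _ sL)) mulr_sumr.
rewrite -[in LHS](subn0 N) -/(index_iota 0 N) big_mkord.
by apply: eq_bigr => p _; rewrite /F /=; ring.
Qed.

Lemma finite_seq_gap (R : realType) (L : seq R) (s : R) :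
  exists2 e : R, 0 < e & forall t, t \in L -> s < t -> s + e < t.
Proof.
elim: L => [|a L [e e0 H]]; first by exists 1.
have [as_|sa] := leP a s.
  exists e => // t; rewrite inE => /predU1P[->|]; last exact: H.
  by rewrite ltNge as_.
have m0 : 0 < Num.min e ((a - s) / 2) by rewrite lt_min e0 divr_gt0 // subr_gt0.
exists (Num.min e ((a - s) / 2)) => // t; rewrite inE => /predU1P[->|tL] st.
  have : Num.min e ((a - s) / 2) <= (a - s) / 2 by rewrite ge_min lexx orbT.
  by move=> h; lra.
have := H t tL st; have : Num.min e ((a - s) / 2) <= e by rewrite ge_min lexx.
by move=> h; lra.
Qed.

(** * From polyhomogeneous functions to symbols and truncated expansions *)

Section Conversion.
Variables (R : realType) (n : nat) (T : topologicalType).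
Variable X : mfd_corners R n T.
Variables (U : 'I_(nhyp X) -> set T) (pi : 'I_(nhyp X) -> T -> T).
Hypothesis hcol : forall j, collar j (U j) (pi j).
Implicit Types (u v w : T -> R) (J : {set 'I_(nhyp X)}) (Q : T -> {poly R}).

Let oU j : open (U j) := collar_open hcol j.

Lemma smooth_on_log_term J j s N Q : j \notin J ->
  (forall p, smooth_on X (face_interior (j |: J)%SET) (fun y => (Q y)`_p)) ->
  (forall y, (size (Q y) <= N)%N) ->
  smooth_on X (collar_face U J j) (log_term pi j s Q).
Proof.
move=> jJ HQ QN; have rho0 x : collar_face U J j x -> 0 < bdf j x.
  by move=> [Jx _]; exact: face_bdf_gt0 Jx jJ.
have Sr : smooth_on X (collar_face U J j) (bdf j).
  exact: sub_smooth_on (bdf_smooth j).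
apply: smooth_onM.
  apply: (@smooth_on_comp_line _ _ _ X _ [set x | 0 < x]
    (fun x => x `^ s) (bdf j)) => //.
  exact: powR_smooth_line.
under eq_fun do rewrite (horner_coef_wide _ (QN _)).
apply: smooth_on_sum => p _; apply: smooth_onM.
  exact: (collar_pullback_smooth hcol jJ (HQ p)).
apply: smooth_onX.
apply: (@smooth_on_comp_line _ _ _ X _ [set x | 0 < x] (@ln R) (bdf j)) => //.
exact: ln_smooth_line.
Qed.

Lemma symbol_of_foldr J j m r u : smooth_on X (collar_face U J j) u ->
  (forall Vs, (forall i, (i < size Vs)%N -> b_field X (nth (fun=> 0) Vs i)) ->
     growth U J j r (foldr (lie X) u Vs)) -> symbol U J j m r u.
Proof.
elim: m u => [|m IH] u Su H.
  by split => //; exact: (H [::]).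
split => //; first exact: (H [::]).
move=> V bV; apply: IH.
  by apply: smooth_on_lie => //; exact: collar_face_stable.
move=> Vs HVs; rewrite -foldr_rcons; apply: H => i.
rewrite size_rcons ltnS leq_eqVlt nth_rcons => /predU1P[->|iVs].
  by rewrite ltnn eqxx.
by rewrite iVs; exact: HVs.
Qed.

Lemma growth_foldr J j r u (Vs : seq (T -> 'rV[R]_n)) :
  (forall i, (i < size Vs)%N -> b_field X (nth (fun=> 0) Vs i)) ->
  symbol U J j (size Vs) r u -> growth U J j r (foldr (lie X) u Vs).
Proof.
elim/last_ind: Vs u => [|Vs V IH] u HVs; first exact: symbol_growth.
rewrite size_rcons foldr_rcons => -[_ _ Hu]; apply: IH.
  move=> i iVs; have := HVs i; rewrite nth_rcons iVs size_rcons ltnS; apply.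
  exact: ltnW.
by apply: Hu; have := HVs (size Vs); rewrite nth_rcons ltnn eqxx size_rcons; apply.
Qed.

Lemma has_expansion_of_symbol E J j u a :
  (forall r m, symbol U J j m r
     (fun x => u x - partial_expansion E (bdf j) a (pi j) r x)) ->
  has_expansion E (U j) (pi j) J j u a.
Proof.
by move=> H r Vs HVs K cK KU; have := growth_foldr HVs (H r (size Vs)); apply.
Qed.

Section ToPc.
Variables (E E' : 'I_(nhyp X) -> set (R * nat)).
Hypothesis hE : index_family E.
Hypothesis EE' : forall j, E j `<=` E' j.
Hypothesis Ege0 : forall j s p, E j (s, p) -> 0 <= s.
Hypothesis E0 : forall j, E' j (0, 0%N).
Hypothesis ED : forall j s p s' p', E' j (s, p) -> E' j (s', p') ->
  E' j (s + s', (p + p')%N).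

Section Terms.
Variables (J : {set 'I_(nhyp X)}) (j : 'I_(nhyp X)) (u : T -> R).
Variable a : R -> nat -> T -> R.
Hypothesis jJ : j \notin J.
Hypothesis Su : smooth_on X (face_interior J) u.
Hypothesis Sa : forall s p, smooth_on X (face_interior (j |: J)%SET)
  (fun y => if `[< E j (s, p) >] then a s p y else 0).
Hypothesis Hexp : has_expansion (E j) (U j) (pi j) J j u a.

Lemma exponents_seq r : exists2 L : seq R, uniq L &
  forall s, s \in L <-> s <= r /\ exists p, E j (s, p).
Proof.
have [/(_ r)/finite_seqP[L LE] _ _ _] := hE j.
exists (undup L) => [|s]; first exact: undup_uniq.
by rewrite mem_undup; have := congr1 (@^~ s) LE; rewrite /= => <-.
Qed.

Lemma log_degree_bound s : exists N, forall p, E j (s, p) -> (p < N)%N.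
Proof.
have [_ /(_ s)/finite_seqP[L LE] _ _] := hE j.
exists (\max_(p <- L) p).+1 => p Ep; rewrite ltnS.
by apply: leq_bigmax_seq => //; have := congr1 (@^~ p) LE; rewrite /= => <-.
Qed.

Lemma expansion_terms : exists Q : R -> T -> {poly R},
  [/\ forall s p y, (Q s y)`_p = if `[< E j (s, p) >] then a s p y else 0,
      forall r L, uniq L -> (forall s, s \in L <-> s <= r /\ exists p, E j (s, p)) ->
        forall m, symbol U J j m r
          (fun x => u x - \sum_(s <- L) log_term pi j s (Q s) x) &
      forall s m, near_symbol U J j m s (log_term pi j s (Q s))].
Proof.
have [N HN] := choice log_degree_bound.
(* [phg_on_face] says nothing about [a s p] when (s, p) is not in [E j], so those coefficients are
   replaced by 0. *)
pose Q s y := \poly_(p < N s) (if `[< E j (s, p) >] then a s p y else 0).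
have QE s p y : (Q s y)`_p = if `[< E j (s, p) >] then a s p y else 0.
  by rewrite coef_poly; case: ifPn => //; case: asboolP => // /HN ->.
have Q0 s y : ~ (exists p, E j (s, p)) -> Q s y = 0.
  move=> ns; apply/polyP => p; rewrite coef0 QE; case: asboolP => // Ep.
  by exfalso; apply: ns; exists p.
have SQ s : smooth_on X (collar_face U J j) (log_term pi j s (Q s)).
  apply: (@smooth_on_log_term J j s (N s)) => //.
    by move=> p; under eq_fun do rewrite QE; exact: Sa.
  by move=> y; exact: size_poly.
have H2 r L : uniq L -> (forall s, s \in L <-> s <= r /\ exists p, E j (s, p)) ->
    forall m, symbol U J j m r
      (fun x => u x - \sum_(s <- L) log_term pi j s (Q s) x).
  move=> uL LE m.
  have PE x : partial_expansion (E j) (bdf j) a (pi j) r x =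
      \sum_(s <- L) log_term pi j s (Q s) x.
    apply: (@fsbig_poly _ (E j) (fun s p => a s p (pi j x))) => //.
      by move=> s /LE[].
    move=> s sr sL; apply: Q0 => Es; move/negP: sL; apply.
    by apply/LE.
  rewrite (_ : (fun x => _) =
    fun x => u x - partial_expansion (E j) (bdf j) a (pi j) r x); last first.
    by apply/funext => x; rewrite PE.
  apply: symbol_of_foldr; last first.
    by move=> Vs HVs K cK KU; have := @Hexp r Vs HVs K cK KU; exact.
  apply: smooth_onB; first by apply: sub_smooth_on Su => x [].
  by rewrite (funext PE); apply: smooth_on_sum.
exists Q; split => // s m.
have [Es|nEs] := pselect (exists p, E j (s, p)); last first.
  rewrite (_ : log_term pi j s (Q s) = fun=> 0); first exact/symbol_near/symbol0.
  by apply/funext => x; rewrite /log_term Q0 // horner0 mulr0.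
move=> e e0; have [Ls uLs LsE] := exponents_seq s.
(* Subtract the truncations at s and at s - e', where no exponent lies in
   the interval ]s - e', s[. *)
have [d d0 Hd] := finite_seq_gap [seq - t | t <- Ls] (- s).
pose e' := Num.min d e.
have e'0 : 0 < e' by rewrite lt_min d0 e0.
have e'd : e' <= d by rewrite ge_min lexx.
have e'e : e' <= e by rewrite ge_min lexx orbT.
have [L uL LE] := exponents_seq (s - e').
have pL : perm_eq Ls (s :: L).
  apply: uniq_perm => //=.
    rewrite uL andbT; apply/negP => /LE[]; lra.
  move=> t; rewrite inE; apply/idP/orP.
    move=> tLs; have [ts Et] := (LsE t).1 tLs.
    have [->|nts] := eqVneq t s; [by left|right].
    have h : - s < - t by rewrite ltrN2 lt_neqAle nts.
    have := Hd (- t) (map_f _ tLs) h => h2.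
    by apply/LE; split => //; lra.
  move=> [/eqP ->|/LE[h Et]]; apply/LsE; split => //; lra.
suff H : symbol U J j m (s - e') (log_term pi j s (Q s)).
  by apply: (le_symbol jJ _ H); rewrite lerD2l lerN2.
have Hs : symbol U J j m (s - e')
    (fun x => u x - \sum_(t <- Ls) log_term pi j t (Q t) x).
  by apply: (le_symbol jJ _ (H2 s Ls uLs LsE m)); rewrite gerBl ltW.
have HL := H2 _ L uL LE m.
have HN1 := symbolM oU jJ (symbol_cst oU J j m (-1)) Hs; rewrite add0r in HN1.
apply: (eq_symbol oU) (symbolD oU HL HN1) => x _.
by rewrite (perm_big _ pL) /= big_cons; ring.
Qed.

End Terms.

(** This is where [E] is enlarged to [E']: the algebra of truncated expansions uses that the index
    sets contain (0, 0) and are closed under addition. *)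
Lemma pc_of_phg d J u : phg_on_face E U pi J u -> pc U pi E' d J u.
Proof.
elim: d J u => [|d IH] J u; case=> {}J {}u a Su Ha Hexp; split => // j jJ r.
pose b s p := fun y => if `[< E j (s, p) >] then a j s p y else 0.
have Pb s p : pc U pi E' d (j |: J)%SET (b s p).
  rewrite /b; case: asboolP => Esp; last exact: pc_cst.
  exact/IH/Ha.
have [Q [QE H2 H3]] :=
  expansion_terms jJ Su (fun s p => pc_smooth (Pb s p)) (Hexp j jJ).
have [L uL LE] := exponents_seq j r.
exists (fun x => \sum_(s <- L) log_term pi j s (Q s) x); split; last exact: H2.
have : forall s, s \in L -> exists p, E j (s, p) by move=> s /LE[].
elim: (L) => [|s L' IHL] HL.
  by under eq_fun do rewrite big_nil; exact: log_span0.
under eq_fun do rewrite big_cons; apply: log_spanD; last first.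
  by apply: IHL => t tL; apply: HL; rewrite inE tL orbT.
have [p Ep] := HL s (mem_head _ _); split => //.
- exact: Ege0 Ep.
- by move=> q; under eq_fun do rewrite QE; exact: Pb.
- by move=> y q nE'; rewrite QE asboolF // => /EE'.
Qed.

End ToPc.

(** * Coefficients are determined by the asymptotics *)

Section Uniqueness.
Variables (J : {set 'I_(nhyp X)}) (j : 'I_(nhyp X)).
Hypothesis jJ : j \notin J.

(** Divide by the largest monomial. Along the boundary filter the other terms tend to 0, and so does
    the whole sum, which is O(rho^m) with [m] above all exponents; hence the leading coefficient
    vanishes at [y]. Its term can then be dropped and the argument repeated. *)
Lemma monomial_coef_eq0 (d : R * nat -> T -> R) (S : seq (R * nat)) m :
  (forall z, smooth_on X (face_interior (j |: J)%SET) (d z)) ->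
  uniq S -> sorted (@lex_le R) S -> (forall z, z \in S -> z.1 < m) ->
  growth U J j m (fun x => \sum_(z <- S) d z (pi j x) * monomial z (bdf j x)) ->
  forall z y, z \in S -> face_interior (j |: J)%SET y -> d z y = 0.
Proof.
move=> Sd; elim: S => [//|z0 S IH] /= /andP[z0S uS] pS Sm G.
have dom z : z \in S -> dominates z0 z.
  move=> zS; apply: lex_le_dominates.
    by have /allP := order_path_min (@lex_le_trans R) pS; apply.
  by apply: contraNneq z0S => ->.
have d0 y : face_interior (j |: J)%SET y -> d z0 y = 0.
  move=> hy; have [F [FF Fy FW HF]] := boundary_filter hcol jJ hy.
  have [C HC] := HF _ _ G.
  have rc := bdf_boundary_cvg jJ hy FF Fy FW.
  have ratio z : dominates z0 z ->
      monomial z (bdf j x) / monomial z0 (bdf j x) @[x --> F] --> 0.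
    by move=> /monomial_ratio_cvg; exact: (cvg_comp _ _ rc).
  have c1 : d z0 (pi j x) @[x --> F] --> d z0 y.
    exact: (coef_boundary_cvg hcol jJ hy FF Fy FW (Sd _)).
  have nX : \forall x \near F, monomial z0 (bdf j x) != 0.
    have H : \forall x \near (0 : R)^'+, monomial z0 x != 0.
      have n1 : \forall x \near (0 : R)^'+, 0 < x < 1.
        near=> x; apply/andP; split; near: x;
          [exact: nbhs_right_gt|exact: nbhs_right_lt].
      apply: filterS n1 => x xI; have /andP[x0 x1] := xI.
      rewrite mulf_neq0 ?expf_neq0 //.
        by rewrite (gt_eqF (powR_gt0 _ x0)).
      by rewrite (lt_eqF (ln_lt0 xI)).
    exact: rc _ H.
  have c2 : \sum_(z <- S) d z (pi j x) * (monomial z (bdf j x) / monomial z0 (bdf j x))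
      @[x --> F] --> 0.
    elim: (S) dom => [|z S' IHS] domS.
      by under eq_fun do rewrite big_nil; exact: cvg_cst.
    have A : d z (pi j x) * (monomial z (bdf j x) / monomial z0 (bdf j x))
        @[x --> F] --> 0.
      have := cvgM (coef_boundary_cvg hcol jJ hy FF Fy FW (Sd z))
        (ratio z (domS z (mem_head _ _))).
      by rewrite mulr0; exact.
    have B := IHS (fun t tS => domS t (mem_behead (s := z :: S') tS)).
    have := cvgD A B; rewrite addr0 => H.
    under eq_fun do rewrite big_cons; exact: H.
  have c3 : (\sum_(z <- z0 :: S) d z (pi j x) * monomial z (bdf j x)) /
      monomial z0 (bdf j x) @[x --> F] --> 0.
    have c3' : C * (monomial (m, 0%N) (bdf j x) / monomial z0 (bdf j x))
        @[x --> F] --> 0.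
      rewrite -[X in _ --> X](mulr0 C); apply: cvgMr; apply: ratio.
      by rewrite /dominates /= Sm ?mem_head.
    apply/cvgr0Pnorm_lt => e e0.
    have H : \forall x \near F,
        `|C * (monomial (m, 0%N) (bdf j x) / monomial z0 (bdf j x))| < e.
      by move/cvgr0Pnorm_lt: c3'; exact.
    apply: filterS2 HC H => x h1; apply: le_lt_trans.
    rewrite (mulrA C) normrM [leRHS]normrM ler_wpM2r //.
    rewrite (le_trans h1) // /monomial /= expr0 mulr1.
    exact: ler_norm.
  have c4 : (\sum_(z <- z0 :: S) d z (pi j x) * monomial z (bdf j x)) /
      monomial z0 (bdf j x) -
      \sum_(z <- S) d z (pi j x) * (monomial z (bdf j x) / monomial z0 (bdf j x))
      @[x --> F] --> 0.
    by have := cvgB c3 c2; rewrite subr0; exact.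
  have c5 : d z0 (pi j x) @[x --> F] --> 0.
    apply/cvgr0Pnorm_lt => e e0.
    move/cvgr0Pnorm_lt: c4 => /(_ e e0) H.
    apply: filterS2 nX H => x Xx; rewrite big_cons mulrDl mulfK // mulr_suml.
    under [X in _ + X - _]eq_bigr do rewrite -mulrA.
    by rewrite addrK.
  exact: (cvg_unique (@norm_hausdorff _ _) c1 c5).
move=> z y; rewrite inE => /predU1P[->|zS] hy; first exact: d0.
apply: IH zS hy => //; first exact: path_sorted pS.
  by move=> t tS; apply: Sm; rewrite inE tS orbT.
apply: eq_growth G => x Wx; rewrite big_cons d0 ?mul0r ?add0r //.
exact: (collar_retract_face hcol jJ Wx).
Unshelve. all: by end_near. Qed.

Lemma log_term_eq0 (D : R -> T -> {poly R}) (L : seq R) N m :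
  (forall s p, smooth_on X (face_interior (j |: J)%SET) (fun y => (D s y)`_p)) ->
  (forall s y, s \in L -> (size (D s y) <= N)%N) ->
  uniq L -> (forall s, s \in L -> s < m) ->
  growth U J j m (fun x => \sum_(s <- L) log_term pi j s (D s) x) ->
  forall s y, s \in L -> face_interior (j |: J)%SET y -> D s y = 0.
Proof.
move=> SD DN uL Lm G s y sL hy.
pose Z := [seq (s, p) | s <- L, p <- iota 0 N].
have uZ : uniq Z.
  by rewrite allpairs_uniq // ?iota_uniq // => -[? ?] [? ?] _ _ [-> ->].
pose S := sort (@lex_le R) Z.
have ZS : perm_eq S Z by rewrite perm_sort.
have H : forall z y, z \in S -> face_interior (j |: J)%SET y -> (D z.1 y)`_z.2 = 0.
  apply: (@monomial_coef_eq0 (fun z y => (D z.1 y)`_z.2) S m) => //.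
  - by rewrite (perm_uniq ZS).
  - by apply: sort_sorted; exact: lex_le_total.
  - by move=> z; rewrite (perm_mem ZS) => /allpairsP[[t p] /= [tL _ ->]]; exact: Lm.
  - apply: eq_growth G => x Wx; rewrite (perm_big _ ZS) /= big_allpairs.
    rewrite big_seq [RHS]big_seq; apply: eq_bigr => t tL.
    rewrite /log_term (horner_coef_wide _ (DN _ _ tL)) mulr_sumr.
    rewrite -[in RHS](subn0 N) -/(index_iota 0 N) big_mkord.
    by apply: eq_bigr => p _; rewrite /monomial /=; ring.
apply/polyP => p; rewrite coef0.
have [pN|Np] := ltnP p N; last by rewrite nth_default // (leq_trans (DN _ _ sL)).
apply: (H (s, p)) => //; rewrite (perm_mem ZS).
by apply/allpairsP; exists (s, p); split => //=; rewrite mem_iota.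
Qed.

End Uniqueness.

End Conversion.

(** * Coherent coefficients *)

Section ToPhg.
Variables (R : realType) (n : nat) (T : topologicalType).
Variable X : mfd_corners R n T.
Variables (U : 'I_(nhyp X) -> set T) (pi : 'I_(nhyp X) -> T -> T).
Hypothesis hcol : forall j, collar j (U j) (pi j).
Variable E : 'I_(nhyp X) -> set (R * nat).
Hypothesis E0 : forall j, E j (0, 0%N).
Hypothesis hE : index_family E.
Implicit Types (u v w : T -> R) (J : {set 'I_(nhyp X)}) (Q : T -> {poly R}).

Let oU j : open (U j) := collar_open hcol j.

Lemma blockD J j P s Q Q' :
  (forall u v, P u -> P v -> P (fun x => u x + v x)) ->
  block U pi E J j P s Q -> block U pi E J j P s Q' ->
  block U pi E J j P s (fun y => Q y + Q' y).
Proof.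
move=> PD [s0 PQ EQ HQ] [_ PQ' EQ' HQ']; split => //.
- by move=> p; under eq_fun do rewrite coefD; exact: PD.
- by move=> y p nE; rewrite coefD EQ // EQ' // addr0.
- move=> m; apply: (eq_near_symbol oU) (near_symbolD oU (HQ m) (HQ' m)) => x _.
  by rewrite /log_term hornerD mulrDr.
Qed.

(** Uniqueness compares coefficients exponent by exponent, so blocks that share an exponent must
    first be added into a single polynomial. *)
Lemma span_collect J j P v :
  (forall u v, P u -> P v -> P (fun x => u x + v x)) ->
  log_span U pi E J j P v -> exists (Q : R -> T -> {poly R}) (L : seq R),
    [/\ uniq L, forall s, s \in L -> block U pi E J j P s (Q s),
        forall s y, s \notin L -> Q s y = 0 &
        forall x, v x = \sum_(s <- L) log_term pi j s (Q s) x].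
Proof.
move=> PD; elim=> [|s Q0 w bQ0 _ [Q [L [uL bQ zQ Ew]]]].
  by exists (fun _ _ => 0), [::]; split => // x; rewrite big_nil.
pose Q' t y := if t == s then Q t y + Q0 y else Q t y.
have E1 L' x : uniq L' -> s \in L' ->
    \sum_(t <- L') log_term pi j t (Q' t) x =
    log_term pi j s Q0 x + \sum_(t <- L') log_term pi j t (Q t) x.
  move=> uL' sL'.
  rewrite !(bigD1_seq s sL' uL') /= addrA; congr (_ + _).
    by rewrite /log_term /Q' eqxx hornerD mulrDr addrC.
  by apply: eq_bigr => t ts; rewrite /log_term /Q' (negbTE ts).
have bs : s \in L -> block U pi E J j P s (fun y => Q s y + Q0 y).
  by move=> sL; apply: blockD => //; exact: bQ.
have bt t : t \in L -> block U pi E J j P t (Q' t).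
  move=> tL; rewrite /Q'; have [ts|ts] := eqVneq t s; last exact: bQ.
  by rewrite ts; apply: bs; rewrite -ts.
have [sL|sL] := boolP (s \in L).
  exists Q', L; split => //.
    move=> t y tL; rewrite /Q'; have [ts|_] := eqVneq t s; last exact: zQ.
    by rewrite ts sL in tL.
  by move=> x; rewrite E1 // Ew.
exists Q', (s :: L); split => //=.
- by rewrite sL.
- move=> t; rewrite inE => /predU1P[->|]; last exact: bt.
  have -> // : Q' s = Q0.
  by apply/funext => y; rewrite /Q' eqxx zQ // add0r.
- move=> t y; rewrite inE negb_or => /andP[ts tL].
  by rewrite /Q' (negbTE ts) zQ.
- move=> x; rewrite E1 /= ?sL ?mem_head // Ew big_cons.
  congr (_ + _); rewrite -[LHS]add0r; congr (_ + _).
  by rewrite /log_term zQ // horner0 mulr0.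
Qed.

Section Coherence.
Variables (J : {set 'I_(nhyp X)}) (j : 'I_(nhyp X)) (u : T -> R) (d : nat).
Hypothesis jJ : j \notin J.
Let P := pc U pi E d (j |: J)%SET.
Hypothesis Hu : forall r, exists v, log_span U pi E J j P v /\
  forall m, symbol U J j m r (fun x => u x - v x).

(* Truncations of different orders have the same coefficients, since these
   are determined by the asymptotics of u at the boundary. *)
Lemma coherent_coefs : exists a : R -> nat -> T -> R,
  (forall s p, P (a s p)) /\ has_expansion (E j) (U j) (pi j) J j u a.
Proof.
have PD u1 u2 : P u1 -> P u2 -> P (fun x => u1 x + u2 x) by exact: pcD.
have HQL r : exists QL : (R -> T -> {poly R}) * seq R,
    [/\ uniq QL.2, forall s, s \in QL.2 -> block U pi E J j P s (QL.1 s),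
        forall s y, s \notin QL.2 -> QL.1 s y = 0 &
        forall m, symbol U J j m r
          (fun x => u x - \sum_(s <- QL.2) log_term pi j s (QL.1 s) x)].
  have [v [sv Ev]] := Hu r; have [Q [L [uL bQ zQ EL]]] := span_collect PD sv.
  exists (Q, L); split => // m.
  by apply: (eq_symbol oU) (Ev m) => x _; rewrite EL.
have [QL {}HQL] := choice HQL.
pose Q r := (QL r).1; pose L r := (QL r).2.
have uL r : uniq (L r) by have [] := HQL r.
have bQ r s : s \in L r -> block U pi E J j P s (Q r s).
  by have [_ H _ _] := HQL r; exact: H.
have zQ r s y : s \notin L r -> Q r s y = 0 by have [_ _ H _] := HQL r; exact: H.
have HS r m : symbol U J j m r
    (fun x => u x - \sum_(s <- L r) log_term pi j s (Q r s) x).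
  by have [_ _ _ H] := HQL r; exact: H.
have PQ r s p : P (fun y => (Q r s y)`_p).
  have [sL|sL] := boolP (s \in L r); first by have [_ H _ _] := bQ r s sL; exact: H.
  under eq_fun do rewrite zQ // coef0; exact: pc_cst.
have EQ r s y p : ~ E j (s, p) -> (Q r s y)`_p = 0.
  have [sL|sL] := boolP (s \in L r); first by have [_ _ H _] := bQ r s sL; exact: H.
  by rewrite zQ // coef0.
have NQ r s m : near_symbol U J j m s (log_term pi j s (Q r s)).
  have [sL|sL] := boolP (s \in L r); first by have [_ _ _ H] := bQ r s sL; exact: H.
  rewrite (_ : log_term pi j s (Q r s) = fun=> 0); first exact/symbol_near/symbol0.
  by apply/funext => x; rewrite /log_term zQ // horner0 mulr0.
have widen r M x : uniq M -> {subset L r <= M} ->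
    \sum_(s <- M) log_term pi j s (Q r s) x = \sum_(s <- L r) log_term pi j s (Q r s) x.
  move=> uM LM; rewrite (bigID (mem (L r))) /= addrC big1 ?add0r.
    rewrite -big_filter; apply: perm_big; apply: uniq_perm => //.
      exact: filter_uniq.
    by move=> t; rewrite mem_filter; case tL: (t \in L r) => //=; exact: LM.
  by move=> t tL; rewrite /log_term zQ // horner0 mulr0.
have coh r q s y : s < r -> s < q -> face_interior (j |: J)%SET y -> Q r s y = Q q s y.
  move=> sr sq hy; pose D t y := Q r t y - Q q t y.
  pose M := undup (s :: L r ++ L q).
  have uM : uniq M by exact: undup_uniq.
  have Lr : {subset L r <= M}.
    by move=> t tL; rewrite mem_undup inE mem_cat tL orbT.
  have Lq : {subset L q <= M}.
    by move=> t tL; rewrite mem_undup inE mem_cat tL !orbT.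
  have DE t x : log_term pi j t (D t) x =
      log_term pi j t (Q r t) x - log_term pi j t (Q q t) x.
    by rewrite /log_term /D hornerD hornerN mulrBr.
  have ND t m : near_symbol U J j m t (log_term pi j t (D t)).
    have H := near_symbolB oU jJ (NQ r t m) (NQ q t m).
    by apply: (eq_near_symbol oU) H => x _; rewrite DE.
  (* [s + e] stays below both truncation orders and below every exponent of [M] larger than [s]. The
     terms of the difference with exponent at most [s] therefore sum to O(rho^(s + e)), and
     uniqueness applies to them. *)
  have [e e0 He] := finite_seq_gap (r :: q :: M) s.
  have er : s + e < r by apply: He => //; rewrite mem_head.
  have eq : s + e < q by apply: He => //; rewrite !inE eqxx orbT.
  suff : D s y = 0 by move=> /eqP; rewrite subr_eq0 => /eqP.
  have [N HN] : exists N, forall t, t \in M -> forall p, E j (t, p) -> (p < N)%N.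
    elim: (M) => [|t M' [N IH]]; first by exists 0%N.
    have [N' HN'] := log_degree_bound hE j t.
    exists (maxn N' N) => t'; rewrite inE => /predU1P[->|tM] p Ep.
      by rewrite (leq_trans (HN' p Ep)) // leq_maxl.
    by rewrite (leq_trans (IH _ tM p Ep)) // leq_maxr.
  apply: (@log_term_eq0 _ _ _ X U pi hcol J j jJ D [seq t <- M | t <= s] N (s + e)).
  - move=> t p; under eq_fun do rewrite coefB.
    by apply: smooth_onB; exact: pc_smooth (PQ _ _ _).
  - move=> t z; rewrite mem_filter => /andP[_ tM]; apply/leq_sizeP => p Np.
    have nE : ~ E j (t, p) by move=> /(HN t tM); rewrite ltnNge Np.
    by rewrite coefB !EQ // subrr.
  - exact: filter_uniq.
  - by move=> t; rewrite mem_filter => /andP[ts _]; rewrite (le_lt_trans ts) // ltrDl.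
  - have Sq : symbol U J j 0 (s + e)
        (fun x => u x - \sum_(t <- L q) log_term pi j t (Q q t) x).
      exact: (le_symbol jJ (ltW eq) (HS q 0%N)).
    have Sr : symbol U J j 0 (s + e)
        (fun x => u x - \sum_(t <- L r) log_term pi j t (Q r t) x).
      exact: (le_symbol jJ (ltW er) (HS r 0%N)).
    have Sm c : symbol U J j 0 0 (fun=> c) by exact: symbol_cst.
    have Sr' := symbolM oU jJ (Sm (-1)) Sr; rewrite add0r in Sr'.
    have S3 : symbol U J j 0 (s + e)
        (fun x => \sum_(t <- M | ~~ (t <= s)) - log_term pi j t (D t) x).
      have : {subset M <= M} by [].
      elim: {1 3}M => [|t M' IH] HM.
        by under eq_fun do rewrite big_nil; exact: symbol0.
      have {}IH := IH (fun t' h => HM t' (mem_behead (s := t :: M') h)).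
      case ts: (~~ (t <= s)); under eq_fun do rewrite big_cons ts; last exact: IH.
      apply: symbolD => //.
      have st : s + e < t.
        apply: He; last by rewrite ltNge.
        by rewrite !inE HM ?mem_head ?orbT.
      have H := symbolM oU jJ (Sm (-1)) (near_symbol_lt st (ND t 0%N)).
      rewrite add0r in H; apply: (eq_symbol oU) H => x _; by rewrite mulN1r.
    apply: eq_growth (symbol_growth (symbolD oU (symbolD oU Sq Sr') S3)) => x _.
    have HM : \sum_(t <- M) log_term pi j t (D t) x =
        \sum_(t <- L r) log_term pi j t (Q r t) x -
        \sum_(t <- L q) log_term pi j t (Q q t) x.
      by rewrite -(widen r M x) // -(widen q M x) // -sumrB; apply: eq_bigr => t _.
    move: HM; rewrite big_filter (bigID (fun t => t <= s)) /= sumrN => HM; lra.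
  - by rewrite mem_filter lexx mem_undup mem_head.
  - exact: hy.
(* By [coh], truncations agree at exponents strictly below their orders; the coefficient at [s] is
   thus read from an order larger than [s]. *)
exists (fun s p y => (Q (s + 1) s y)`_p); split => //.
apply: has_expansion_of_symbol => r m.
(* A remainder bounded by rho^r alone does not fix the coefficients at exponent [r] itself. The
   truncation at [q] does, and its terms with exponent above [r] go into the remainder. *)
pose q := r + 1; have rq : r < q by rewrite ltrDl.
have PE x : collar_face U J j x ->
    partial_expansion (E j) (bdf j) (fun s p y => (Q (s + 1) s y)`_p) (pi j) r x =
    \sum_(s <- [seq s <- L q | s <= r]) log_term pi j s (Q q s) x.
  move=> Wx; have hx := collar_retract_face hcol jJ Wx.
  apply: (@fsbig_poly _ (E j) (fun s p => (Q (s + 1) s (pi j x))`_p)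
    (fun s => Q q s (pi j x))).
  - move=> s p sr; case: asboolP => [Ep|]; last exact: EQ.
    rewrite (coh q (s + 1) s) //; first exact: le_lt_trans rq.
    by rewrite ltrDl.
  - exact: filter_uniq.
  - by move=> s; rewrite mem_filter => /andP[].
  - by move=> s sr; rewrite mem_filter sr /=; exact: zQ.
have S3 : symbol U J j m r
    (fun x => \sum_(s <- L q | ~~ (s <= r)) log_term pi j s (Q q s) x).
  elim: (L q) => [|t M' IH].
    by under eq_fun do rewrite big_nil; exact: symbol0.
  case ts: (~~ (t <= r)); under eq_fun do rewrite big_cons ts; last exact: IH.
  by apply: symbolD => //; apply: near_symbol_lt (NQ q t m); rewrite ltNge.
apply: (eq_symbol oU) (symbolD oU (le_symbol jJ (ltW rq) (HS q m)) S3) => x Wx.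
rewrite PE // big_filter (bigID (fun s => s <= r)) /=; ring.
Qed.

End Coherence.

(** The number of hypersurfaces outside [J] drops when [J] grows to [j |: J], so depth [d] suffices
    to unfold all faces; when none is left, [phg_on_face] only asks for smoothness. *)
Lemma phg_of_pc d J u : (#|~: J| <= d)%N -> pc U pi E d J u ->
  phg_on_face E U pi J u.
Proof.
elim: d J u => [|d IH] J u Jd Hu.
  have J0 j : j \notin J -> False.
    move=> jJ; have := card_gt0 (~: J).
    by rewrite ltnNge Jd => /esym/negbFE/eqP/setP/(_ j); rewrite !inE jJ.
  apply: (@PhgOnFace _ _ _ _ _ _ _ _ _ (fun _ _ _ _ => 0)) => //.
  - exact: pc_smooth Hu.
  - by move=> j s p /J0.
  - by move=> j /J0.
have [Su Hj] := Hu.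
have H j : exists a : R -> nat -> T -> R, j \notin J ->
    (forall s p, pc U pi E d (j |: J)%SET (a s p)) /\
    has_expansion (E j) (U j) (pi j) J j u a.
  have [jJ|jJ] := boolP (j \in J); first by exists (fun _ _ _ => 0).
  by have [a Ha] := coherent_coefs jJ (Hj j jJ); exists a.
have [a Ha] := choice H.
apply: (@PhgOnFace _ _ _ _ _ _ _ _ _ a) => // [j s p jJ _|j jJ].
  apply: IH; last by have [] := Ha j jJ.
  rewrite finset.setCU -ltnS (leq_trans _ Jd) //; apply: proper_card.
  rewrite properE; apply/andP; split.
    by apply/fintype.subsetP => k; rewrite !inE => /andP[].
  by apply/fintype.subsetPn; exists j; rewrite !inE // eqxx.
by have [] := Ha j jJ.
Qed.

End ToPhg.

(** * Index sets *)

Section IndexMonoid.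
Variable R : realType.
Implicit Types (A B : set (R * nat)) (z w : R * nat).

Definition nonneg_index A := forall z, A z -> 0 < z.1 \/ z = (0, 0%N).

Lemma seq_extremum (S : eqType) (le : rel S) (s : seq S) x :
  total le -> transitive le -> x \in s ->
  exists2 y, y \in s & forall t, t \in s -> le y t.
Proof.
move=> tot tr xs; have := sort_sorted tot s.
have ss : sort le s =i s by move=> y; rewrite mem_sort.
case: (sort le s) ss => [|y s'] ss; first by have := ss x; rewrite xs in_nil.
move=> /= p; exists y; first by rewrite -ss mem_head.
move=> z; rewrite -ss inE => /predU1P[->|zs]; first by have := tot y y; rewrite orbb.
by have /allP := order_path_min tr p; apply.
Qed.

Lemma finite_set_extremum (S : choiceType) (le : rel S) (B : set S) x :
  total le -> transitive le -> finite_set B -> B x ->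
  exists2 y, B y & forall t, B t -> le y t.
Proof.
move=> tot tr /finite_seqP[s ->] Bx.
by have [y ys H] := seq_extremum tot tr (Bx : x \in s); exists y.
Qed.

(** [index_inf_ge0] constrains an infimum only if there is one. In a nonempty index set it is
    attained: take the least exponent, then the largest power of the logarithm at that exponent. *)
Lemma index_inf_nonneg A : index_set A -> index_inf_ge0 A -> nonneg_index A.
Proof.
move=> [A1 A2 _ _] Ainf [s0 p0] As0 /=.
have B0 : [set s | s <= s0 /\ exists p, A (s, p)] s0 by split => //; exists p0.
have [s [ss0 [p Asp]] smin] :=
  finite_set_extremum (@le_total _ R) (@le_trans _ R) (A1 s0) B0.
have geq_total : total geq by move=> a b; exact: leq_total.
have geq_trans : transitive geq by move=> a b c ba ac; exact: leq_trans ac ba.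
have [q Asq qmax] := finite_set_extremum geq_total geq_trans (A2 s) Asp.
have sle t k : A (t, k) -> s <= t.
  move=> Atk; have [ts0|s0t] := leP t s0; last exact: le_trans (ltW s0t).
  by apply: smin; split => //; exists k.
have : is_index_inf A (s, q).
  split => // -[t k] Atk /=.
  move: (sle _ _ Atk); rewrite le_eqVlt => /predU1P[st|]; [right|by left].
  by split => //; apply: qmax; rewrite /= st.
move=> /Ainf /= [s_gt0|[s0E q0E]]; first by left; exact: lt_le_trans s_gt0 (sle _ _ As0).
have := sle _ _ As0; rewrite s0E le_eqVlt => /predU1P[s00|]; [right|by left].
have := qmax p0; rewrite /= s0E s00 q0E leqn0 => /(_ As0) /eqP ->.
by rewrite -s00.
Qed.

Lemma index_set_finite A r : index_set A -> finite_set [set z | A z /\ z.1 <= r].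
Proof.
move=> [A1 A2 _ _].
apply: (@sub_finite_set _ _ (\bigcup_(s in [set s | s <= r /\ exists p, A (s, p)])
  ((fun p => (s, p)) @` [set p | A (s, p)]))).
  move=> [s p] /= [Asp sr]; exists s; first by split => //; exists p.
  by exists p.
by apply: bigcup_finite => // s _; exact: finite_image.
Qed.

(** The generator (1, 0) provides stability under s -> s + 1, and the empty sum (0, 0) accommodates
    constants. Adding one generator at a time gives the induction used for the gap and for
    finiteness. *)
Inductive index_monoid A : set (R * nat) :=
| IndexMonoid0 : index_monoid A (0, 0%N)
| IndexMonoidD s p t q : A (s, p) \/ (s, p) = (1, 0%N) ->
    index_monoid A (t, q) -> index_monoid A (s + t, (p + q)%N).

Lemma index_monoid_add A s p t q : index_monoid A (s, p) ->
  index_monoid A (t, q) -> index_monoid A (s + t, (p + q)%N).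
Proof.
move=> H H'; move Ez: (s, p) H => z H.
elim: H s p Ez => [|s' p' t' q' Hs _ IH] s p [-> ->]; first by rewrite add0r.
by rewrite -addrA -addnA; apply: IndexMonoidD => //; exact: IH.
Qed.

Lemma sub_index_monoid A : A `<=` index_monoid A.
Proof.
move=> [s p] Asp; rewrite -[s]addr0 -[p]addn0.
by apply: IndexMonoidD; [left|exact: IndexMonoid0].
Qed.

Section Nonneg.
Variable A : set (R * nat).
Hypotheses (iA : index_set A) (nA : nonneg_index A).

(** Only finitely many exponents of [A] are at most 1, so the positive ones among them are bounded
    away from 0; the cap at 1 covers (1, 0) and the larger exponents. *)
Lemma generator_gap : exists s0 : R, [/\ 0 < s0, s0 <= 1 &
  forall s p, A (s, p) \/ (s, p) = (1, 0%N) -> s0 <= s \/ (s, p) = (0, 0%N)].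
Proof.
have fA : finite_set [set s | s <= 1 /\ exists p, A (s, p)] by have [H _ _ _] := iA.
have /finite_seqP[L LE] := fA.
have [e e0 He] := finite_seq_gap L 0.
have m0 : 0 < Num.min e 1 by rewrite lt_min e0 ltr01.
have m1 : Num.min e 1 <= 1 by rewrite ge_min lexx orbT.
exists (Num.min e 1); split => // s p [Asp|[-> ->]]; last by left.
have [s_gt0|] := nA Asp; [left|by right].
have [s1|] := leP s 1; last by move=> /ltW; exact: le_trans.
have sL : s \in L.
  by have := congr1 (@^~ s) LE; rewrite /= => <-; split => //; exists p.
have := He s sL s_gt0; rewrite add0r => /ltW; apply: le_trans.
by rewrite ge_min lexx.
Qed.

Lemma index_monoid_gap : exists s0 : R, [/\ 0 < s0, s0 <= 1 &
  forall s p, index_monoid A (s, p) -> s0 <= s \/ (s = 0 /\ p = 0%N)].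
Proof.
have [s0 [s0_gt0 s01 Hs0]] := generator_gap; exists s0; split => // s p.
move Ez: (s, p) => z H; elim: H s p Ez => [|s' p' t q Hs _ IH] s p [-> ->]; first by right.
have [s0s'|[-> ->]] := Hs0 _ _ Hs; last by rewrite add0r add0n; exact: IH.
left; apply: (le_trans s0s'); rewrite lerDl.
by have [|[-> _]] := IH t q erefl; [move=> h; exact: ltW (lt_le_trans s0_gt0 h)|].
Qed.

Lemma index_monoid_ge0 s p : index_monoid A (s, p) -> 0 <= s.
Proof.
have [s0 [s0_gt0 _ H]] := index_monoid_gap.
by move=> /H[|[-> _]] // h; exact: ltW (lt_le_trans s0_gt0 h).
Qed.

(** A generator other than (0, 0) costs at least [s0]. A nonzero element with exponent at most
    [c + s0] is thus one of finitely many generators plus an element with exponent at most [c], and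
    finitely many steps of length [s0] reach [r]. *)
Lemma index_monoid_finite r : finite_set [set z | index_monoid A z /\ z.1 <= r].
Proof.
have [s0 [s0_gt0 s01 Hs0]] := generator_gap.
have fG r' : finite_set [set z | (A z \/ z = (1, 0%N)) /\ z.1 <= r'].
  apply: (@sub_finite_set _ _ ([set z | A z /\ z.1 <= r'] `|` [set (1, 0%N)])).
    by move=> z [[Az|->] zr]; [left|right].
  by rewrite finite_setU; split; [exact: index_set_finite|exact: finite_set1].
suff H (k : nat) : finite_set [set z | index_monoid A z /\ z.1 <= k%:R * s0].
  apply: sub_finite_set (H (Num.Def.archi_bound `|r / s0|)) => z /= [Mz zr].
  split => //; apply: (le_trans zr); rewrite -ler_pdivrMr //.
  rewrite (le_trans (ler_norm _)) // ltW //; exact: archi_boundP.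
have key (c : R) : finite_set [set z | index_monoid A z /\ z.1 <= c] ->
    finite_set [set z | index_monoid A z /\ z.1 <= c + s0].
  move=> fc; apply: (@sub_finite_set _ _ ([set (0, 0%N)] `|`
    ((fun x : (R * nat) * (R * nat) => (x.1.1 + x.2.1, (x.1.2 + x.2.2)%N)) @`
     ([set z | (A z \/ z = (1, 0%N)) /\ z.1 <= c + s0] `*`
      [set z | index_monoid A z /\ z.1 <= c])))); last first.
    rewrite finite_setU; split; first exact: finite_set1.
    by apply: finite_image; apply: finite_setX.
  move=> z [Mz]; elim: Mz => [|s p t q Hs Mt IH] /= stc; first by left.
  have [s0s|[s00 p0]] := Hs0 _ _ Hs; last first.
    by rewrite s00 p0 add0r add0n in stc *; exact: IH.
  have t0 := index_monoid_ge0 Mt.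
  right; exists ((s, p), (t, q)) => //=; split; split => //=; lra.
elim: k => [|k IH]; last by rewrite -natr1 mulrDl mul1r; exact: key.
apply: (@sub_finite_set _ _ [set (0, 0%N)]); last exact: finite_set1.
move=> [s p] /= [Ms]; rewrite mul0r => s_le0.
have [s1 [s1_gt0 _ H]] := index_monoid_gap.
have [h|[-> ->]] // := H _ _ Ms.
by have := lt_le_trans s1_gt0 (le_trans h s_le0); rewrite ltxx.
Qed.

Lemma index_monoid_index_set : index_set (index_monoid A).
Proof.
split.
- move=> r; apply: sub_finite_set (finite_image (fun z => z.1) (index_monoid_finite r)).
  by move=> s /= [sr [p Msp]]; exists (s, p).
- move=> s; apply: sub_finite_set (finite_image (fun z => z.2) (index_monoid_finite s)).
  by move=> p /= Msp; exists (s, p).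
- move=> s p Msp; rewrite addrC -[p]add0n.
  by apply: IndexMonoidD => //; right.
(* A positive degree comes from some generator of positive degree. It cannot be (1, 0), so it lies
   in [A], where its degree can be lowered by one. *)
- have [_ _ _ Adown] := iA.
  move=> s p; move Ez: (s, p.+1) => z H.
  elim: H s p Ez => [//|s' p' t q Hs Mt IH] s p [-> E].
  case: p' Hs E => [|p'] Hs E.
    rewrite -[p]add0n; apply: IndexMonoidD => //; apply: IH.
    by congr (_, _).
  have [Asp|//] := Hs.
  move: E; rewrite addSn => -[->]; apply: IndexMonoidD => //.
  by left; exact: Adown.
Qed.

End Nonneg.
End IndexMonoid.

Theorem theoremB1 (R : realType) (n : nat) (T : topologicalType)
    (X : mfd_corners R n T) (E : 'I_(nhyp X) -> set (R * nat))
    (hE : index_family E) (g : T -> R) (hg : phg E g)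
    (hinf : forall j, index_inf_ge0 (E j))
    (f : R -> R) (O : set R) (hO : open O) (hf : smooth_line O f)
    (hcompact : compact (closure (g @` mfd_interior X)))
    (hsub : closure (g @` mfd_interior X) `<=` O) :
  exists E' : 'I_(nhyp X) -> set (R * nat),
    index_family E' /\ phg E' (f \o g).
Proof.
have nE j : nonneg_index (E j) := index_inf_nonneg (hE j) (hinf j).
pose E' j := index_monoid (E j).
have E'0 j : E' j (0, 0%N) by exact: IndexMonoid0.
have E'D j s p s' p' : E' j (s, p) -> E' j (s', p') -> E' j (s + s', (p + p')%N).
  exact: index_monoid_add.
have E'i : index_family E'.
  by move=> j; apply: index_monoid_index_set; [exact: hE|exact: nE].
have EE' j : E j `<=` E' j by exact: sub_index_monoid.
exists E'; split => //.
have [U [pi [hcol hpg]]] := hg.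
exists U, pi; split => //.
have Ege0 j s p : E j (s, p) -> 0 <= s by move=> /nE[/ltW|[->]].
(* On X itself all hypersurfaces are still to be treated, so the depth is their total number. *)
apply: (phg_of_pc hcol E'0 E'i (d := #|~: (finset.set0 : {set 'I_(nhyp X)})|)) => //.
apply: (pc_comp hcol E'0 E'D _ hO hcompact hsub hf).
- by move=> j; exact: index_monoid_gap (hE j) (nE j).
- by move=> x hx; apply: subset_closure; exists x.
- exact: (pc_of_phg hcol hE EE' Ege0 E'0).
Qed.
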